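(* Let $L$ be a $\mathrm{gl}$-regular Nijenhuis operator in a neighbourhood of a point $\mathsf p$ of an $n$-dimensional manifold, with $\det(\lambda\,\mathrm{Id}-L)=\lambda^n-\sigma_1\lambda^{n-1}-\dots-\sigma_n$, and let $A_0,\dots,A_{n-1}$ be the operator fields defined by $$A_0=\mathrm{Id},\qquad A_{i+1}=LA_i-\sigma_{i+1}\mathrm{Id},$$ or, equivalently, by $\det(\lambda\,\mathrm{Id}-L)(\lambda\,\mathrm{Id}-L)^{-1}=\lambda^{n-1}A_0+\lambda^{n-2}A_1+\dots+A_{n-1}$. Then: 1. For any hierarchy of conservation laws $\mathrm{d}f_1,\dots,\mathrm{d}f_n$ of $L$, the operator field $$B=f_1A_{n-1}+f_2A_{n-2}+\dots+f_nA_0$$ is a common symmetry of all $A_i$. Moreover, every common symmetry of the $A_i$'s in a neighbourhood of $\mathsf p$ can be written in this way with an appropriate choice of the hierarchy (with functions $f_1,\dots,f_n$). 2. For any symmetry $M=g_1L^{n-1}+\dots+g_n\mathrm{Id}$ of $L$, the differential $\mathrm{d}g_1$ of the first function $g_1$ is a common conservation law of all $A_i$; in particular, $$A_i^*\,\mathrm{d}g_1=\mathrm{d}g_{i+1},\qquad i=1,\dots,n-1.$$ Moreover, every common conservation law of the $A_i$'s in a neighbourhood of $\mathsf p$ can be obtained in this way with an appropriate choice of a symmetry $M$ of $L$.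
   Context: An operator field is a field of endomorphisms of the tangent bundle. All objects are smooth (the statement holds equally with everything real analytic), and all statements are local. For a 1-form $\alpha$, $(L^*\alpha)(\xi)=\alpha(L\xi)$. Nijenhuis operator: an operator field $L$ with $L^2[\xi,\eta]-L[L\xi,\eta]-L[\xi,L\eta]+[L\xi,L\eta]=0$ for all vector fields $\xi,\eta$. $\mathrm{gl}$-regular: at each point $L$ admits a cyclic vector, i.e. a tangent vector $\xi$ with $\xi,L\xi,\dots,L^{n-1}\xi$ linearly independent. In this case every operator field $M$ commuting with $L$ is uniquely written as $M=g_1L^{n-1}+\dots+g_n\mathrm{Id}$ with functions $g_i$. Symmetry: for commuting operator fields $A,M$ put $\langle A,M\rangle(\xi,\eta)=M[A\xi,\eta]+A[\xi,M\eta]-[A\xi,M\eta]-AM[\xi,\eta]$; $M$ is a symmetry of $A$ if $AM=MA$ and $\langle A,M\rangle(\xi,\xi)=0$ for all vector fields $\xi$. A common symmetry of the $A_i$ is an operator field that is a symmetry of each $A_i$, $i=0,\dots,n-1$. Conservation law of an operator field $A$: a closed 1-form $\mathrm{d}f$ such that $\mathrm{d}(A^*\mathrm{d}f)=0$; a common conservation law of the $A_i$ is a closed 1-form that is a conservation law of each $A_i$. A hierarchy of conservation laws of $L$ is a sequence $\mathrm{d}f_1,\dots,\mathrm{d}f_n$, with $\mathrm{d}f_1$ a conservation law of $L$ and $L^*\mathrm{d}f_i=\mathrm{d}f_{i+1}$ for $i=1,\dots,n-1$. *)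

(* Defs.v *)
From HB Require Import structures.
From mathcomp Require Export all_boot all_order all_algebra.
From mathcomp Require Export all_classical all_reals all_analysis.
Export Order.TTheory GRing.Theory Num.Theory numFieldNormedType.Exports.

Set Implicit Arguments.
Unset Strict Implicit.
Unset Printing Implicit Defensive.

#[global] Open Scope classical_set_scope.
#[global] Open Scope ring_scope.

(* Everything is written in a coordinate chart: points and tangent vectors are
   columns of R^(n+1), 1-forms are rows, so that the manifold has dimension
   n + 1 >= 1.  Fields are total functions, and only their values on an open
   set U matter.  The families sigma_1, ..., sigma_(n+1) and A_0, ..., A_n keep
   their usual indices; the families f_1, ..., f_(n+1) and g_1, ..., g_(n+1)
   are indexed from 0 by 'I_n.+1, that is, f i stands for f_(i+1). *)

Section Smooth.
Context {R : realType} {n : nat} {W : normedModType R}.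
Implicit Types (U : set 'cV[R]_n.+1) (f : 'cV[R]_n.+1 -> W).

Fixpoint class_C (k : nat) U f : Prop :=
  match k with
  | 0 => forall x, U x -> {for x, continuous f}
  | k'.+1 => (forall x, U x -> differentiable f x) /\
             (forall v, class_C k' U (fun x => 'D_v f x))
  end.

Definition smooth_on U f : Prop := forall k, class_C k U f.

End Smooth.

Section Fields.
Context {R : realType} {n : nat}.

Definition vfield := 'cV[R]_n.+1 -> 'cV[R]_n.+1.
Definition oneform := 'cV[R]_n.+1 -> 'rV[R]_n.+1.
Definition opfield := 'cV[R]_n.+1 -> 'M[R]_n.+1.

Implicit Types (U : set 'cV[R]_n.+1) (xi eta : vfield) (alpha : oneform).
Implicit Types (A L M : opfield) (h : 'cV[R]_n.+1 -> R).

Definition lie_bracket xi eta : vfield :=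
  fun x => 'D_(xi x) eta x - 'D_(eta x) xi x.

Definition op_app A xi : vfield := fun x => A x *m xi x.

Definition op_mul A M : opfield := fun x => A x *m M x.

Definition op_dual A alpha : oneform := fun x => alpha x *m A x.

Definition basis_vec (j : 'I_n.+1) : 'cV[R]_n.+1 := delta_mx j 0.

Definition dfun h : oneform := fun x => \row_j 'D_(basis_vec j) h x.

Definition closed_form U alpha : Prop :=
  forall x, U x -> forall i j : 'I_n.+1,
    'D_(basis_vec i) (fun y => alpha y 0 j) x =
    'D_(basis_vec j) (fun y => alpha y 0 i) x.

Definition nijenhuis U L : Prop :=
  forall xi eta : vfield, smooth_on U xi -> smooth_on U eta ->
  forall x, U x ->
    op_app (op_mul L L) (lie_bracket xi eta) x
    - op_app L (lie_bracket (op_app L xi) eta) x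
    - op_app L (lie_bracket xi (op_app L eta)) x
    + lie_bracket (op_app L xi) (op_app L eta) x = 0.

Definition gl_regular U L : Prop :=
  forall x, U x -> exists v : 'cV[R]_n.+1,
    free [seq L x ^+ k *m v | k <- iota 0 n.+1].

Definition sym_bracket A M xi eta : vfield := fun x =>
  op_app M (lie_bracket (op_app A xi) eta) x
  + op_app A (lie_bracket xi (op_app M eta)) x
  - lie_bracket (op_app A xi) (op_app M eta) x
  - op_app (op_mul A M) (lie_bracket xi eta) x.

Definition symmetry U A M : Prop :=
  [/\ smooth_on U M,
      forall x, U x -> A x *m M x = M x *m A x
    & forall xi : vfield, smooth_on U xi ->
      forall x, U x -> sym_bracket A M xi xi x = 0].

Definition conservation_law U A alpha : Prop :=
  [/\ smooth_on U alpha, closed_form U alpha & closed_form U (op_dual A alpha)].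

Definition hierarchy U L (f : 'I_n.+1 -> 'cV[R]_n.+1 -> R) : Prop :=
  [/\ forall i, smooth_on U (f i),
      conservation_law U L (dfun (f ord0))
    & forall i j : 'I_n.+1, j = i.+1 :> nat ->
      forall x, U x -> op_dual L (dfun (f i)) x = dfun (f j) x].

Definition sigma L (i : nat) : 'cV[R]_n.+1 -> R :=
  fun x => - (char_poly (L x))`_(n.+1 - i).

Lemma char_poly_sigma L x :
  char_poly (L x) =
    'X^(n.+1) - \sum_(1 <= i < n.+2) sigma L i x *: 'X^(n.+1 - i).
Proof.
have szp := size_char_poly (L x).
rewrite -[LHS]coefK szp poly_def big_ord_recr /=.
have -> : (char_poly (L x))`_n.+1 = 1.
  by have /monicP := char_poly_monic (L x); rewrite lead_coefE szp.
rewrite scale1r addrC; congr (_ + _).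
rewrite big_add1 /= big_mkord -sumrN (reindex_inj rev_ord_inj) /=.
by apply: eq_bigr => i _; rewrite /sigma scaleNr opprK subSS.
Qed.

Fixpoint opA L (i : nat) : opfield :=
  match i with
  | 0 => fun=> 1%:M
  | i'.+1 => fun x => L x *m opA L i' x - (sigma L i'.+1 x)%:M
  end.

Definition common_symmetry U L M : Prop :=
  forall i : 'I_n.+1, symmetry U (opA L i) M.

Definition common_conservation_law U L alpha : Prop :=
  forall i : 'I_n.+1, conservation_law U (opA L i) alpha.

Definition opB L (f : 'I_n.+1 -> 'cV[R]_n.+1 -> R) : opfield :=
  fun x => \sum_(i < n.+1) f i x *: opA L (n - i) x.

Definition op_poly L (g : 'I_n.+1 -> 'cV[R]_n.+1 -> R) : opfield :=
  fun x => \sum_(i < n.+1) g i x *: L x ^+ (n - i).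

End Fields.

Arguments vfield : clear implicits.
Arguments oneform : clear implicits.
Arguments opfield : clear implicits.

(* Main.v *)
(* The families f_i, g_i are indexed by 0, ..., n, the dimension being n + 1.
   At a point, <A, M>(u, v) depends only on the values of A and M and on their
   derivatives there, and <A, LM>(u, v) = <A, L>(u, Mv) + L <A, M>(u, v).

   Jacobi's formula gives d sigma_(k+1)(v) = tr(A_k D_v L), and the trace of the
   Nijenhuis identity turns this into d sigma_(k+1) = A_k^* theta with
   theta = d sigma_1.  Induction on k then yields
   <L, A_k>(u, v) = theta(A_k u) v - theta(u) A_k v, and a second induction
   <A_j, A_k>(v, v) = 0.

   Hence for B = sum f_i A_(n-i) the expression <A_j, B>(v, v) only involves the
   differentials df_i.  It vanishes for a hierarchy because
   sum (L^i)^* (x) A_(n-i) intertwines L on the two factors (Cayley-Hamilton).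
   Conversely, for cyclic v the vectors A_k v are independent, so <A_1, B>(v, v) = 0
   gives df_(i+1) = L^* df_i, first on cyclic vectors and then everywhere, since
   these span.  The same computation with <L, M> and M = sum g_i L^(n-i) shows that
   M is a symmetry of L iff dg_i = A_i^* dg_0 for all i; primitives g_i of the
   forms A_i^* alpha come from the Poincare lemma on a ball. *)
From mathcomp Require Import ring perm.
Require Import Defs.

Set Implicit Arguments.
Unset Strict Implicit.
Unset Printing Implicit Defensive.

(** * Smooth functions *)

Section SmoothCalculus.
Context {R : realType} {n : nat}.
Local Notation X := 'cV[R]_n.+1.

(** The two halves of the theorem are dual. Let chi be the characteristic polynomial, and let X and
    Y act on an operator K by multiplication by L on the right and on the left. The quotient (chi(X)
    - chi(Y)) / (X - Y) is symmetric in X and Y, so it expands both as the sum of the A_(n-i)(Y) X^i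
    and as the sum of the Y^(n-i) A_i(X). The first expansion, at the rank-one operator K = v df_0,
    treats hierarchies; the second, at K = v alpha, treats conservation laws. Each time the bracket
    to be killed is a commutator with the resulting operator, applied to v. Regularity is the other
    concern. Cyclic vectors are given point by point, without any continuity, and yet the
    coefficients of a common symmetry must be smooth on all of U. Smoothness asks for
    differentiability as well as for directional derivatives of all orders, so a primitive obtained
    by integration has to be shown differentiable, and the closedness of exact forms rests on
    exchanging two directional derivatives. A primitive needs a star-shaped domain, which is why
    conservation laws are integrated near p only, while common symmetries are described on the whole
    of U. *)

Lemma differentiable_approx (V W : normedModType R) (f : V -> W)
    (l : {linear V -> W}) (x : V) : continuous l ->
  (forall e : R, 0 < e ->
     \forall h \near 0, `|f (h + x) - (f x + l h)| <= e * `|h|) -> differentiable f x.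
Proof.
move=> lc fl.
have e : f \o shift x = cst (f x) + l +o_ 0 id by apply/eqaddoP.
by apply/diff_locallyP; rewrite (diff_unique lc e).
Qed.

Lemma near_eq_differentiable (V W : normedModType R) (f g : V -> W) (x : V) :
  (\near x, f x = g x) -> differentiable f x -> differentiable g x.
Proof.
move=> fg df.
have sfg : \forall h \near 0, f (h + x) = g (h + x).
  by move: fg; rewrite (near_shift 0) /= subr0.
apply: (differentiable_approx (diff_continuous df)) => e e0; near=> h.
rewrite -(near sfg h) // -(nbhs_singleton fg); near: h.
by have /eqaddoP := diff_locally df; exact.
Unshelve. all: by end_near. Qed.

Lemma cvg_mx (T : Type) (F : set_system T) (p q : nat) (A : T -> 'M[R]_(p, q))
    (B : 'M[R]_(p, q)) : Filter F ->
  (forall i j, A y i j @[y --> F] --> B i j) -> A y @[y --> F] --> B.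
Proof.
move=> FF cA; apply/cvgrPdist_le => /= e e0; near=> y.
rewrite /Num.Def.normr/= mx_normrE (bigmax_le _ (ltW e0))//= => i _.
rewrite !mxE/=; move: i; near: y; apply: filter_forall => /= i.
exact: ((cvgrPdist_le _ _).1 (cA i.1 i.2)).
Unshelve. all: by end_near. Qed.

Lemma differentiable_mxP (V : normedModType R) (p q : nat) (A : V -> 'M[R]_(p, q)) x :
  differentiable A x <-> forall i j, differentiable (fun y => A y i j) x.
Proof.
split=> [dA i j|dA].
  apply: (differentiable_comp dA (g := fun M : 'M[R]_(p,q) => M i j)).
  exact: differentiable_coord.
have -> : A = \sum_(i < p) \sum_(j < q) (fun y => A y i j *: delta_mx i j).
  apply/funext => y; rewrite [LHS]matrix_sum_delta fct_sumE.
  by apply: eq_bigr => i _; rewrite fct_sumE.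
apply: differentiable_sum => i; apply: differentiable_sum => j.
exact: differentiableZl.
Qed.

Lemma class_C_eq (W : normedModType R) k (U : set X) (f g : X -> W) :
  open U -> (forall x, U x -> f x = g x) -> class_C k U f -> class_C k U g.
Proof.
move=> oU fg; have nfg (h1 h2 : X -> W) : (forall x, U x -> h1 x = h2 x) ->
    forall x, U x -> \near x, h1 x = h2 x.
  move=> h12 x Ux; have nU : nbhs x U by exact: open_nbhs_nbhs.
  exact: filterS nU.
elim: k f g fg => [|k IH] f g fg /=.
  move=> cf x Ux; have := cf _ Ux; rewrite /prop_for /continuous_at (fg _ Ux).
  by apply: (cvg_trans (near_eq_cvg (nfg _ _ fg _ Ux))).
move=> [df Df]; split=> [x Ux|v].
  by apply: near_eq_differentiable (df _ Ux); exact: (nfg _ _ fg).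
by apply: IH (Df v) => x Ux; apply: near_eq_derive; exact: (nfg _ _ fg).
Qed.

Lemma class_CW (W : normedModType R) k (U : set X) (f : X -> W) :
  class_C k.+1 U f -> class_C k U f.
Proof.
elim: k f => [|k IH] f.
  by move=> [df _] x Ux; exact: differentiable_continuous (df _ Ux).
by move=> [df Df]; split=> // v; apply: IH; exact: Df.
Qed.

(** Every condition in [class_C] is tested at one point at a time, on derivatives of the total
    function in the whole space; hence V may be any set containing the point, open or not. *)
Lemma class_C_locally (W : normedModType R) k (U : set X) (f : X -> W) :
  (forall x, U x -> exists2 V : set X, V x & class_C k V f) -> class_C k U f.
Proof.
elim: k f => [|k IH] f loc /=.
  by move=> x Ux; have [V Vx fV] := loc _ Ux; exact: fV.
split=> [x Ux|v]; first by have [V Vx [fV _]] := loc _ Ux; exact: fV.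
apply: IH => x Ux; have [V Vx [_ fV]] := loc _ Ux.
by exists V => //; exact: fV.
Qed.

Lemma class_CS (W : normedModType R) k (U V : set X) (f : X -> W) :
  V `<=` U -> class_C k U f -> class_C k V f.
Proof. by move=> VU fU; apply: class_C_locally => x /VU Ux; exists U. Qed.

Lemma class_C_cst (W : normedModType R) k (U : set X) (a : W) :
  class_C k U (fun=> a).
Proof.
elim: k a => [|k IH] a /=; first by move=> x _; exact: cst_continuous.
split=> [x _|v]; first exact: differentiable_cst.
have -> : (fun x : X => 'D_v (fun=> a) x) = (fun=> 0).
  by apply/funext => x; exact: derive_cst.
exact: IH.
Qed.

Lemma class_CD (W : normedModType R) k (U : set X) (f g : X -> W) : open U ->
  class_C k U f -> class_C k U g -> class_C k U (fun x => f x + g x).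
Proof.
move=> oU; elim: k f g => [|k IH] f g /=.
  by move=> cf cg x Ux; exact: (cvgD (cf _ Ux) (cg _ Ux)).
move=> [df Df] [dg Dg]; split=> [x Ux|v].
  by apply: differentiableD; [exact: df|exact: dg].
apply: class_C_eq (IH _ _ (Df v) (Dg v)) => // x Ux.
by rewrite [RHS]deriveD //; apply: diff_derivable; [exact: df|exact: dg].
Qed.

Lemma class_CM k (U : set X) (f g : X -> R) : open U ->
  class_C k U f -> class_C k U g -> class_C k U (fun x => f x * g x).
Proof.
move=> oU; elim: k f g => [|k IH] f g.
  by move=> cf cg x Ux; exact: (cvgM (cf _ Ux) (cg _ Ux)).
move=> cf cg; have [cf' cg'] := (class_CW cf, class_CW cg).
case: cf cg => df Df [dg Dg]; split=> [x Ux|v].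
  by apply: differentiableM; [exact: df|exact: dg].
apply: class_C_eq (class_CD oU (IH _ _ cf' (Dg v)) (IH _ _ cg' (Df v))) => // x Ux.
by rewrite [RHS]deriveM //; apply: diff_derivable; [exact: df|exact: dg].
Qed.

Lemma class_CV k (U : set X) (f : X -> R) : open U ->
  (forall x, U x -> f x != 0) -> class_C k U f -> class_C k U (fun x => (f x)^-1).
Proof.
move=> oU f0; elim: k f f0 => [|k IH] f f0.
  by move=> cf x Ux; exact: (cvgV (f0 _ Ux) (cf _ Ux)).
move=> cf; have cf' := class_CW cf.
have cV := IH _ f0 cf'.
case: cf => df Df; split=> [x Ux|v].
  by apply: differentiableV; [exact: df|exact: f0].
have := class_CM oU (@class_C_cst _ k U (-1 : R)) (class_CM oU (class_CM oU cV cV) (Df v)).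
apply: class_C_eq => // x Ux.
rewrite [RHS]deriveV ?f0 //; last by apply: diff_derivable; exact: df.
by rewrite /GRing.scale /= expr2 invfM mulN1r mulNr.
Qed.

Lemma class_C_mxP (p q : nat) k (U : set X) (A : X -> 'M[R]_(p, q)) : open U ->
  class_C k U A <-> forall i j, class_C k U (fun x => A x i j).
Proof.
move=> oU; elim: k A => [|k IH] A.
  split=> [cA i j x Ux|cA x Ux].
    have := @coord_continuous _ p q i j (A x).
    by apply: continuous_comp; exact: cA.
  by apply: (@cvg_mx _ (nbhs x)) => i j; exact: cA.
split=> [[dA DA] i j|cA].
  split=> [x Ux|v]; first by have := dA _ Ux; move/differentiable_mxP; exact.
  have := (IH _).1 (DA v) i j; apply: class_C_eq => // x Ux.
  by rewrite derive_mx ?mxE //; exact/diff_derivable/dA.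
have dA x : U x -> differentiable A x.
  by move=> Ux; apply/differentiable_mxP => i j; have [+ _] := cA i j; exact.
split=> // v; apply/IH => i j; have [_ /(_ v)] := cA i j.
apply: class_C_eq => // x Ux.
by rewrite derive_mx ?mxE //; exact/diff_derivable/dA.
Qed.

End SmoothCalculus.

(** * Symmetry of second derivatives *)

Section Schwarz.
Context {R : realType} {n : nat}.
Local Notation X := 'cV[R]_n.+1.
Implicit Types (f : X -> R).

Lemma is_derive_line (V W : normedModType R) (f : V -> W) (y u : V) (s : R) :
  derivable f (y + s *: u) u ->
  is_derive s 1 (fun t => f (y + t *: u)) ('D_u f (y + s *: u)).
Proof.
move=> dfu.
have E : (fun h => h^-1 *: (((fun t => f (y + t *: u)) \o shift s) (h *: (1:R)) - f (y + s *: u))) =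
   (fun h => h^-1 *: ((f \o shift (y + s *: u)) (h *: u) - f (y + s *: u))).
  apply/funext => h /=; congr (_ *: (f _ - _)).
  by rewrite [h *: 1]mulr1 scalerDl addrCA.
by apply: DeriveDef; rewrite /derivable /derive E.
Qed.

Lemma differentiable_shift (V W : normedModType R) (f : V -> W) (y a : V) :
  differentiable f (y + a) -> differentiable (fun z => f (z + a)) y.
Proof.
move=> df; apply: (differentiable_comp (f := fun z => z + a)) => //.
Qed.

Lemma derive_shift_arg (V W : normedModType R) (f : V -> W) (y a u : V) :
  'D_u (fun z => f (z + a)) y = 'D_u f (y + a).
Proof.
rewrite /derive; set g1 := fun h => _; set g2 := fun h => _.
by have -> : g1 = g2 by apply/funext => h; rewrite /g1 /g2 /= addrA.
Qed.

Lemma MVT_line f (y u : X) (s : R) : 0 < s ->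
  (forall t, 0 <= t <= s -> derivable f (y + t *: u) u) ->
  exists2 c, 0 <= c <= s & f (y + s *: u) - f y = s * 'D_u f (y + c *: u).
Proof.
move=> s0 df.
have dl t : 0 <= t <= s -> is_derive t 1 (fun t => f (y + t *: u)) ('D_u f (y + t *: u)).
  by move=> ht; apply: is_derive_line; exact: df.
have [||c] := @MVT R (fun t => f (y + t *: u)) (fun t => 'D_u f (y + t *: u)) 0 s s0.
- by move=> t; rewrite in_itv /= => /andP[t0 ts]; apply: dl; rewrite !ltW.
- apply: derivable_within_continuous => t; rewrite in_itv /= => ht.
  by have [] := dl _ ht.
rewrite in_itv /= scale0r addr0 subr0 => /andP[c0 cs] ->.
by exists c; rewrite ?ltW // mulrC.
Qed.

(** The mean value theorem is applied twice: along u to the increment of f in direction s v, then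
    along v to ['D_u f]. The left-hand side is symmetric in u and v, the right-hand side is not;
    comparing the two versions exchanges the derivatives. *)
Lemma second_difference (U : set X) f (x u v : X) : open U -> class_C 2 U f -> U x ->
  forall P : set X, nbhs x P -> \forall s \near (0 : R)^'+,
    exists2 y, P y &
      f (x + s *: u + s *: v) - f (x + s *: u) - f (x + s *: v) + f x =
      s ^+ 2 * 'D_v (fun z => 'D_u f z) y.
Proof.
move=> oU [df /(_ u)[dDf _]] Ux P nP.
have nPU : nbhs x (P `&` U) by apply: filterI => //; exact: open_nbhs_nbhs.
have /nbhs_ballP[e /= e0 eP] := nPU.
(* With s below this bound, a |u| + b |v| <= s (|u| + |v|) < e, so the whole parallelogram stays in
   the ball; the summand 1 keeps the denominator positive when u = v = 0. *)
have inP (s a b : R) : 0 < s -> s < e / (`|u| + `|v| + 1) ->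
    0 <= a <= s -> 0 <= b <= s -> (P `&` U) (x + a *: u + b *: v).
  move=> s0 se /andP[a0 as_] /andP[b0 bs]; apply: eP.
  rewrite -ball_normE /ball_ /= -addrA opprD addNKr normrN.
  have uv0 : 0 < `|u| + `|v| + 1 by rewrite ltr_wpDl // addr_ge0.
  rewrite ltr_pdivlMr // in se; apply: le_lt_trans se.
  apply: le_trans (ler_normD _ _) _; rewrite !normrZ !ger0_norm // !mulrDr mulr1.
  by rewrite ler_wpDr ?lerD ?ler_wpM2r // ltW.
near=> s.
have s0 : 0 < s by near: s; exact: nbhs_right_gt.
have se : s < e / (`|u| + `|v| + 1).
  by near: s; apply: nbhs_right_lt; rewrite divr_gt0.
have ss : 0 <= s <= s by rewrite lexx ltW.
have zs : 0 <= (0 : R) <= s by rewrite lexx ltW.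
have {}inP a b := inP _ a b s0 se.
pose g z := f (z + s *: v) - f z.
have dg1 t : 0 <= t <= s -> differentiable (fun z => f (z + s *: v)) (x + t *: u).
  move=> ht; apply: differentiable_shift; apply: df.
  by have [] := inP t s ht ss.
have dg2 t : 0 <= t <= s -> differentiable f (x + t *: u).
  by move=> ht; have [_] := inP t 0 ht zs; rewrite scale0r addr0; exact: df.
have [t ht|c hc] := @MVT_line g x u s s0.
  by apply/diff_derivable/differentiableB; [exact: dg1|exact: dg2].
rewrite [X in _ = _ * X](_ : _ = 'D_u f (x + c *: u + s *: v) - 'D_u f (x + c *: u)); last first.
  rewrite -[in RHS]derive_shift_arg.
  by rewrite [LHS]deriveB //; apply: diff_derivable; [exact: dg1|exact: dg2].
have [t ht|d hd ->] := @MVT_line (fun z => 'D_u f z) (x + c *: u) v s s0.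
  by apply/diff_derivable/dDf; have [] := inP c t hc ht.
rewrite /g => gE; exists (x + c *: u + d *: v); first by have [] := inP c d hc hd.
by rewrite expr2 -mulrA -gE opprB addrA [in RHS]addrAC.
Unshelve. all: by end_near. Qed.

(** One small s is enough: it yields points y and z near x with g y = h z = F s / s^2, and
    continuity bounds the distance from g x to h x by any given e. *)
Lemma second_difference_unique (F : R -> R) (g h : X -> R) x :
  {for x, continuous g} -> {for x, continuous h} ->
  (forall P : set X, nbhs x P ->
     \forall s \near (0 : R)^'+, exists2 y, P y & F s = s ^+ 2 * g y) ->
  (forall P : set X, nbhs x P ->
     \forall s \near (0 : R)^'+, exists2 y, P y & F s = s ^+ 2 * h y) ->
  g x = h x.
Proof.
move=> cg ch Fg Fh; apply/eqP; rewrite -subr_eq0 -normr_le0; apply/ler_addgt0Pr => e e0.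
have e2 : 0 < e / 2 by rewrite divr_gt0.
have /cvgrPdist_lt /(_ _ e2) /Fg H1 := cg.
have /cvgrPdist_lt /(_ _ e2) /Fh H2 := ch.
have [s [s0 [[y gy Ey] [z hz Ez]]]] := filter_ex (filterI (nbhs_right_gt (0 : R)) (filterI H1 H2)).
have gh : g y = h z.
  have s2 : s ^+ 2 != 0 by rewrite expf_neq0 // gt_eqF.
  by apply: (mulfI s2); rewrite -Ey -Ez.
rewrite add0r ltW // -(subrKA (g y)) [ltRHS]splitr.
by rewrite (le_lt_trans (ler_normD _ _)) // ltrD // gh distrC.
Qed.

Lemma derive_comm (U : set X) f (x u v : X) : open U -> class_C 2 U f -> U x ->
  'D_v (fun z => 'D_u f z) x = 'D_u (fun z => 'D_v f z) x.
Proof.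
move=> oU Cf Ux; have [_ Df] := Cf.
apply: (@second_difference_unique (fun s =>
  f (x + s *: u + s *: v) - f (x + s *: u) - f (x + s *: v) + f x)
  ('D_v ('D_u f)) ('D_u ('D_v f))).
- by have [_ /(_ v)] := Df u; exact.
- by have [_ /(_ u)] := Df v; exact.
- by move=> P; exact: second_difference Ux P.
move=> P nP; apply: filterS (second_difference v u oU Cf Ux nP) => s [y Py Ey].
by exists y => //; rewrite -Ey (addrAC x) (addrAC (f _)).
Qed.

End Schwarz.

(* Products that went through ring lemmas carry different, convertible,
   semiring instances; they are first put in the form [@mulmx S0]. *)
Ltac mx_lincomb_over S0 :=
  repeat match goal with
  | |- context [@mulmx ?S ?a ?b ?c ?A ?B] =>
    tryif constr_eq S S0 then fail
    else change (@mulmx S a b c A B) with (@mulmx S0 a b c A B)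
  end;
  repeat match goal with
  | |- context [@mulmx ?S ?a ?b ?c ?A ?B] => generalize (@mulmx S a b c A B); intro
  end; apply/matrixP => ? ?; rewrite !mxE; ring.

Ltac mx_lincomb :=
  match goal with
  | R : realType |- _ =>
    match constr:((0 : 'M[R]_0) *m (0 : 'M[R]_0)) with
    | @mulmx ?S0 _ _ _ _ _ => mx_lincomb_over S0
    end
  end.

(** * Closure properties of smooth fields *)

Section SmoothFields.
Context {R : realType} {n : nat}.
Local Notation X := 'cV[R]_n.+1.
Implicit Types (U : set X).

Lemma smooth_eq (W : normedModType R) U (f g : X -> W) :
  open U -> (forall x, U x -> f x = g x) -> smooth_on U f -> smooth_on U g.
Proof. by move=> oU fg sf k; exact: class_C_eq (sf k). Qed.

Lemma smoothS (W : normedModType R) U V (f : X -> W) :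
  V `<=` U -> smooth_on U f -> smooth_on V f.
Proof. by move=> VU sf k; exact: class_CS (sf k). Qed.

Lemma smooth_locally (W : normedModType R) U (f : X -> W) :
  (forall x, U x -> exists2 V : set X, V x & smooth_on V f) -> smooth_on U f.
Proof.
by move=> loc k; apply: class_C_locally => x /loc[V Vx sV]; exists V.
Qed.

Lemma smooth_cst (W : normedModType R) U (a : W) : smooth_on U (fun=> a).
Proof. by move=> k; exact: class_C_cst. Qed.

Lemma smooth_diff (W : normedModType R) U (f : X -> W) x :
  smooth_on U f -> U x -> differentiable f x.
Proof. by move=> /(_ 1) [df _]; exact: df. Qed.

Lemma smooth_derive (W : normedModType R) U (f : X -> W) v :
  smooth_on U f -> smooth_on U (fun x => 'D_v f x).
Proof. by move=> sf k; have [_] := sf k.+1; exact. Qed.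

Lemma smooth_primitive (W : normedModType R) U (f : X -> W) :
  (forall x, U x -> differentiable f x) ->
  (forall v, smooth_on U (fun x => 'D_v f x)) -> smooth_on U f.
Proof.
move=> df sDf [|k]; last by split=> // v; exact: sDf.
by move=> x Ux; exact/differentiable_continuous/df.
Qed.

Lemma smoothD (W : normedModType R) U (f g : X -> W) : open U ->
  smooth_on U f -> smooth_on U g -> smooth_on U (fun x => f x + g x).
Proof. by move=> oU sf sg k; exact: class_CD. Qed.

Lemma smooth_sum (W : normedModType R) U (I : Type) (r : seq I) (f : I -> X -> W) :
  open U -> (forall i, smooth_on U (f i)) -> smooth_on U (fun x => \sum_(i <- r) f i x).
Proof.
move=> oU sf; elim: r => [|i r IH].
  by apply: smooth_eq (smooth_cst _ 0) => // x _; rewrite big_nil.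
by apply: smooth_eq (smoothD oU (sf i) IH) => // x _; rewrite big_cons.
Qed.

Lemma smoothM U (f g : X -> R) : open U ->
  smooth_on U f -> smooth_on U g -> smooth_on U (fun x => f x * g x).
Proof. by move=> oU sf sg k; exact: class_CM. Qed.

Lemma smooth_prod U (I : Type) (r : seq I) (f : I -> X -> R) :
  open U -> (forall i, smooth_on U (f i)) -> smooth_on U (fun x => \prod_(i <- r) f i x).
Proof.
move=> oU sf; elim: r => [|i r IH].
  by apply: smooth_eq (smooth_cst U (1 : R^o)) => // x _; rewrite big_nil.
by apply: smooth_eq (smoothM oU (sf i) IH) => // x _; rewrite big_cons.
Qed.

Lemma smoothV U (f : X -> R) : open U -> (forall x, U x -> f x != 0) ->
  smooth_on U f -> smooth_on U (fun x => (f x)^-1).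
Proof. by move=> oU f0 sf k; exact: class_CV. Qed.

Lemma smooth_mxP (p q : nat) U (A : X -> 'M[R]_(p, q)) : open U ->
  smooth_on U A <-> forall i j, smooth_on U (fun x => A x i j).
Proof.
move=> oU; split=> [sA i j k|sA k]; first by have /class_C_mxP := sA k; exact.
by apply/class_C_mxP => // i j; exact: sA.
Qed.

Lemma smooth_mulmx (p q r : nat) U (A : X -> 'M[R]_(p, q)) (B : X -> 'M[R]_(q, r)) :
  open U -> smooth_on U A -> smooth_on U B -> smooth_on U (fun x => A x *m B x).
Proof.
move=> oU /smooth_mxP sA /smooth_mxP sB; apply/smooth_mxP => // i k.
have : smooth_on U (fun x => \sum_j A x i j * B x j k).
  by apply: smooth_sum => // j; apply: smoothM => //; [exact: sA|exact: sB].
by apply: smooth_eq => // x _; rewrite mxE.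
Qed.

Lemma smooth_scalemx (p q : nat) U (f : X -> R) (A : X -> 'M[R]_(p, q)) :
  open U -> smooth_on U f -> smooth_on U A -> smooth_on U (fun x => f x *: A x).
Proof.
move=> oU sf /smooth_mxP sA; apply/smooth_mxP => // i j.
by apply: smooth_eq (smoothM oU sf (sA oU i j)) => // x _; rewrite mxE.
Qed.

Lemma smooth_det (p : nat) U (A : X -> 'M[R]_p) :
  open U -> smooth_on U A -> smooth_on U (fun x => \det (A x)).
Proof.
move=> oU /smooth_mxP sA; apply: smooth_sum => // s.
apply: smoothM => //; first exact: smooth_cst.
by apply: smooth_prod => // i; exact: sA.
Qed.

Lemma smooth_expmx U (A : X -> 'M[R]_n.+1) k :
  open U -> smooth_on U A -> smooth_on U (fun x => A x ^+ k).
Proof.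
move=> oU sA; elim: k => [|k IH]; first exact: smooth_cst.
by apply: smooth_eq (smooth_mulmx oU sA IH) => // x _; rewrite exprS.
Qed.

End SmoothFields.

(** * Product rules for matrix-valued maps *)

Section MatrixDerivatives.
Context {R : realType} {V : normedModType R}.
Implicit Types (x u v : V).

Lemma deriveDdir (W : normedModType R) (f : V -> W) x u v :
  differentiable f x -> 'D_(u + v) f x = 'D_u f x + 'D_v f x.
Proof. by move=> df; rewrite !deriveE // linearD. Qed.

Lemma deriveZdir (W : normedModType R) (f : V -> W) x (a : R) u :
  differentiable f x -> 'D_(a *: u) f x = a *: 'D_u f x.
Proof. by move=> df; rewrite !deriveE // linearZ. Qed.

Lemma deriveNdir (W : normedModType R) (f : V -> W) x u :
  differentiable f x -> 'D_(- u) f x = - 'D_u f x.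
Proof. by move=> df; rewrite !deriveE // linearN. Qed.

Lemma differentiable_mulmx (p q r : nat) (A : V -> 'M[R]_(p, q)) (B : V -> 'M[R]_(q, r)) x :
  differentiable A x -> differentiable B x -> differentiable (fun y => A y *m B y) x.
Proof.
move=> /differentiable_mxP dA /differentiable_mxP dB; apply/differentiable_mxP => i k.
rewrite (_ : (fun y => _) = \sum_j (fun y => A y i j * B y j k)); last first.
  by apply/funext => y; rewrite mxE fct_sumE.
by apply: differentiable_sum => j; exact: differentiableM.
Qed.

Lemma derive_mxE (p q : nat) (A : V -> 'M[R]_(p, q)) x v i j :
  differentiable A x -> ('D_v A x) i j = 'D_v (fun y => A y i j) x.
Proof. by move=> dA; rewrite derive_mx ?mxE //; exact: diff_derivable. Qed.

Lemma derive_mulmx (p q r : nat) (A : V -> 'M[R]_(p, q)) (B : V -> 'M[R]_(q, r)) x v :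
  differentiable A x -> differentiable B x ->
  'D_v (fun y => A y *m B y) x = 'D_v A x *m B x + A x *m 'D_v B x.
Proof.
move=> dA dB; apply/matrixP => i k.
rewrite derive_mxE; last exact: differentiable_mulmx.
have /differentiable_mxP eA := dA; have /differentiable_mxP eB := dB.
rewrite (_ : (fun y => _) = \sum_j (fun y => A y i j * B y j k)); last first.
  by apply/funext => y; rewrite mxE fct_sumE.
rewrite derive_sum; last by move=> j; apply/diff_derivable/differentiableM.
rewrite !mxE -big_split /=; apply: eq_bigr => j _.
rewrite [LHS]deriveM; [|exact/diff_derivable..].
by rewrite (derive_mxE _ _ _ dA) (derive_mxE _ _ _ dB) addrC; congr (_ + _); exact: mulrC.
Qed.

Lemma differentiable_scalemx (p q : nat) (f : V -> R) (A : V -> 'M[R]_(p, q)) x :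
  differentiable f x -> differentiable A x -> differentiable (fun y => f y *: A y) x.
Proof.
move=> df /differentiable_mxP dA; apply/differentiable_mxP => i j.
rewrite (_ : (fun y => _) = (fun y => f y * A y i j)); first exact: differentiableM.
by apply/funext => y; rewrite mxE.
Qed.

Lemma derive_scalemx (p q : nat) (f : V -> R) (A : V -> 'M[R]_(p, q)) x v :
  differentiable f x -> differentiable A x ->
  'D_v (fun y => f y *: A y) x = 'D_v f x *: A x + f x *: 'D_v A x.
Proof.
move=> df dA; apply/matrixP => i j.
rewrite derive_mxE; last exact: differentiable_scalemx.
have /differentiable_mxP eA := dA.
rewrite (_ : (fun y => _) = (fun y => f y * A y i j)); last first.
  by apply/funext => y; rewrite mxE.
rewrite [LHS]deriveM; [|exact/diff_derivable..].
by rewrite !mxE (derive_mxE _ _ _ dA) addrC; congr (_ + _); exact: mulrC.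
Qed.

End MatrixDerivatives.

(** * The bracket of two operator fields at a point *)

Section PointwiseBracket.
Context {R : realType} {p : nat}.
Implicit Types (A L M : 'M[R]_p) (a l m : 'cV[R]_p -> 'M[R]_p) (u v w : 'cV[R]_p).

(* The bracket <A, M>(xi, eta) at a point, in terms of the values A, M there
   and of the directional derivatives a, m of the two fields. *)
Definition bracket_at A a M m u v :=
  A *m (m u *m v) - M *m (a v *m u) - m (A *m u) *m v + a (M *m v) *m u.

(** Here [xi w] and [eta w] stand for the derivatives along w of two vector fields with values u and
    v. They cancel because A and M commute, which makes the bracket tensorial. *)
Lemma bracket_at_field A a M m u v (xi eta : 'cV[R]_p -> 'cV[R]_p) : A *m M = M *m A ->
  M *m (eta (A *m u) - (a v *m u + A *m xi v))
  + A *m ((m u *m v + M *m eta u) - xi (M *m v))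
  - (m (A *m u) *m v + M *m eta (A *m u) - (a (M *m v) *m u + A *m xi (M *m v)))
  - A *m M *m (eta u - xi v)
  = bracket_at A a M m u v.
Proof.
move=> AM; rewrite /bracket_at !mulmxBr !mulmxDr !mulmxA AM; mx_lincomb.
Qed.

Lemma bracket_atC A a M m u v : bracket_at M m A a v u = - bracket_at A a M m u v.
Proof. by rewrite /bracket_at; mx_lincomb. Qed.

Lemma bracket_at1 A a m u v : (forall w, m w = 0) -> bracket_at A a 1%:M m u v = 0.
Proof. by move=> m0; rewrite /bracket_at !m0 !mul1mx !mul0mx mulmx0; mx_lincomb. Qed.

Lemma bracket_at0 A a m u v : (forall w, m w = 0) -> a 0 = 0 -> bracket_at A a 0 m u v = 0.
Proof. by move=> m0 a0; rewrite /bracket_at !m0 !mul0mx a0 mul0mx mulmx0; mx_lincomb. Qed.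

Lemma bracket_atD A a M m M' m' md u v :
  (forall v w, a (v + w) = a v + a w) -> (forall w, md w = m w + m' w) ->
  bracket_at A a (M + M') md u v = bracket_at A a M m u v + bracket_at A a M' m' u v.
Proof.
move=> aD mdE; rewrite /bracket_at !mdE !mulmxDl aD !mulmxDr !mulmxDl; mx_lincomb.
Qed.

Lemma bracket_atM A a L l M m lm u v :
  (forall w, lm w = l w *m M + L *m m w) -> A *m L = L *m A ->
  bracket_at A a (L *m M) lm u v =
  bracket_at A a L l u (M *m v) + L *m bracket_at A a M m u v.
Proof.
move=> lmE AL; rewrite /bracket_at !lmE.
rewrite ?(mulmxDl, mulmxDr, mulmxBr, mulmxBl, mulmxN, mulmxA) AL; mx_lincomb.
Qed.

Lemma bracket_atZ A a (f : R) (df : 'cV[R]_p -> R) M m fm u v :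
  (forall s w, a (s *: w) = s *: a w) -> (forall w, fm w = df w *: M + f *: m w) ->
  bracket_at A a (f *: M) fm u v =
  f *: bracket_at A a M m u v + df u *: (A *m M *m v) - df (A *m u) *: (M *m v).
Proof.
move=> aZ fmE; rewrite /bracket_at !fmE -!scalemxAl aZ.
rewrite ?(mulmxDl, mulmxDr, mulmxBr, mulmxBl, mulmxN) -?scalemxAl -?scalemxAr !mulmxA.
mx_lincomb.
Qed.

End PointwiseBracket.

(** * The bracket of operator fields as a tensor *)

Section SymmetryTensor.
Context {R : realType} {n : nat}.
Local Notation X := 'cV[R]_n.+1.
Implicit Types (U : set X) (A L M : opfield R n) (xi eta : vfield R n) (x u v : X).

Definition sym_tensor A M x u v : X :=
  bracket_at (A x) (fun w => 'D_w A x) (M x) (fun w => 'D_w M x) u v.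

Lemma sym_bracketE A M xi eta x :
  differentiable A x -> differentiable M x ->
  differentiable xi x -> differentiable eta x -> A x *m M x = M x *m A x ->
  sym_bracket A M xi eta x = sym_tensor A M x (xi x) (eta x).
Proof.
move=> dA dM dxi deta AM.
have DA w : 'D_w (fun y => A y *m xi y) x = 'D_w A x *m xi x + A x *m 'D_w xi x.
  exact: derive_mulmx.
have DM w : 'D_w (fun y => M y *m eta y) x = 'D_w M x *m eta x + M x *m 'D_w eta x.
  exact: derive_mulmx.
have E1 := f_equal2 (fun a b => a - b) (erefl ('D_(A x *m xi x) eta x)) (DA (eta x)).
have E2 := f_equal2 (fun a b => a - b) (DM (xi x)) (erefl ('D_(M x *m eta x) xi x)).
have E3 := f_equal2 (fun a b => a - b) (DM (A x *m xi x)) (DA (M x *m eta x)).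
have E := f_equal3 (fun a b c => M x *m a + A x *m b - c
  - A x *m M x *m ('D_(xi x) eta x - 'D_(eta x) xi x)) E1 E2 E3.
rewrite /sym_bracket /op_mul /lie_bracket /op_app.
apply: (etrans E).
exact: (bracket_at_field (fun w => 'D_w A x) (fun w => 'D_w M x) (xi x) (eta x)
  (fun w => 'D_w xi x) (fun w => 'D_w eta x) AM).
Qed.

(** By tensoriality the constant fields [cst v] already detect the bracket at each point. *)
Lemma symmetryP U A M : open U -> smooth_on U A ->
  symmetry U A M <->
  [/\ smooth_on U M, forall x, U x -> A x *m M x = M x *m A x
    & forall x v, U x -> sym_tensor A M x v v = 0].
Proof.
move=> oU sA; split=> [] [sM AM S]; split=> //.
  move=> x v Ux.
  have dv := @differentiable_cst _ X X v x.
  rewrite -(sym_bracketE (smooth_diff sA Ux) (smooth_diff sM Ux) dv dv (AM x Ux)).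
  exact: (S (cst v) (smooth_cst U v)).
move=> xi sxi x Ux; have dxi := smooth_diff sxi Ux.
by rewrite (sym_bracketE (smooth_diff sA Ux) (smooth_diff sM Ux) dxi dxi (AM x Ux)) S.
Qed.

(** The Nijenhuis expression is minus the bracket of L with itself. Unlike the symmetry condition it
    vanishes off the diagonal too, and the trace argument needs u and v independent. *)
Lemma nijenhuis_tensor U L x u v : smooth_on U L -> nijenhuis U L -> U x ->
  sym_tensor L L x u v = 0.
Proof.
move=> sL NL Ux.
have dL := smooth_diff sL Ux.
have dcst (w : X) := @differentiable_cst _ X X w x.
rewrite -(sym_bracketE dL dL (dcst u) (dcst v) erefl).
have := NL (cst u) (cst v) (smooth_cst U u) (smooth_cst U v) x Ux.
move=> NLuv; rewrite /sym_bracket.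
have E (a b c d : X) : b + c - d - a = - (a - b - c + d) by mx_lincomb.
by rewrite [LHS]E NLuv oppr0.
Qed.

Lemma sym_tensorC A M x u v : sym_tensor M A x v u = - sym_tensor A M x u v.
Proof. exact: bracket_atC. Qed.

Lemma sym_tensor1 A x u v : sym_tensor A (fun=> 1%:M) x u v = 0.
Proof. by apply: bracket_at1 => w; rewrite derive_cst. Qed.

Lemma sym_tensorD A M M' x u v :
  differentiable A x -> differentiable M x -> differentiable M' x ->
  sym_tensor A (fun y => M y + M' y) x u v = sym_tensor A M x u v + sym_tensor A M' x u v.
Proof.
move=> dA dM dM'; apply: bracket_atD => [w1 w2|w]; first exact: deriveDdir.
by rewrite [LHS]deriveD //; exact: diff_derivable.
Qed.

Lemma sym_tensorM A L M x u v :
  differentiable L x -> differentiable M x -> A x *m L x = L x *m A x ->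
  sym_tensor A (fun y => L y *m M y) x u v =
  sym_tensor A L x u (M x *m v) + L x *m sym_tensor A M x u v.
Proof.
move=> dL dM AL; apply: bracket_atM => // w; exact: derive_mulmx.
Qed.

Lemma sym_tensorZ A (f : X -> R) (df : X -> R) M x u v :
  differentiable A x -> differentiable f x -> differentiable M x ->
  (forall w, 'D_w f x = df w) ->
  sym_tensor A (fun y => f y *: M y) x u v =
  f x *: sym_tensor A M x u v + df u *: (A x *m M x *m v)
  - df (A x *m u) *: (M x *m v).
Proof.
move=> dA fd dM dfE.
apply: bracket_atZ => [s w|w]; first exact: deriveZdir.
by rewrite -dfE; exact: derive_scalemx.
Qed.

Lemma sym_tensorZ1 A (f : X -> R) (df : X -> R) x u v :
  differentiable A x -> differentiable f x -> (forall w, 'D_w f x = df w) ->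
  sym_tensor A (fun y => f y *: 1%:M) x u v = df u *: (A x *m v) - df (A x *m u) *: v.
Proof.
move=> dA fd dfE.
rewrite (@sym_tensorZ _ _ df (fun=> 1%:M)) //.
by rewrite sym_tensor1 scaler0 add0r mulmx1 mul1mx.
Qed.

Lemma sym_tensor_sum A (I : Type) (r : seq I) (M : I -> opfield R n) x u v :
  differentiable A x -> (forall i, differentiable (M i) x) ->
  sym_tensor A (fun y => \sum_(i <- r) M i y) x u v = \sum_(i <- r) sym_tensor A (M i) x u v.
Proof.
move=> dA dM.
have E s : (fun y => \sum_(i <- s) M i y) = \sum_(i <- s) M i.
  by apply/funext => y; rewrite fct_sumE.
have dS s : differentiable (fun y => \sum_(i <- s) M i y) x.
  elim: s => [|i s IH].
    by rewrite E big_nil; exact: differentiable_cst.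
  by rewrite E big_cons; apply: differentiableD; rewrite -?E.
elim: r => [|i r IH].
  rewrite E !big_nil; apply: bracket_at0 => [w|]; first exact: derive_cst.
  by rewrite derive0.
have -> : (fun y => \sum_(j <- i :: r) M j y) = (fun y => M i y + \sum_(j <- r) M j y).
  by apply/funext => y; rewrite big_cons.
by rewrite big_cons -IH; exact: sym_tensorD (dM i) (dS r).
Qed.

End SymmetryTensor.

(** * The operators A_k and the coefficients of the characteristic polynomial *)

Section PolynomialIdentity.
Context {R : realType}.

Lemma poly0_horner (P : {poly R}) : (forall a, P.[a] = 0) -> P = 0.
Proof.
move=> P0; apply/eqP; apply: contraT => Pn0.
have := max_poly_roots (rs := [seq i%:R | i <- iota 0 (size P)]) Pn0.
rewrite size_map size_iota ltnn => -> //.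
  by apply/allP => a _; rewrite rootE P0.
by rewrite map_inj_uniq ?iota_uniq //; exact: mulrIn (oner_neq0 R).
Qed.

(** The product P Q vanishes at every real number. The intended Q is the characteristic polynomial,
    off whose roots a - L is invertible. *)
Lemma poly0_cofinite (P Q : {poly R}) : Q != 0 ->
  (forall a, Q.[a] != 0 -> P.[a] = 0) -> P = 0.
Proof.
move=> Q0 PQ; have /eqP : P * Q = 0.
  apply: poly0_horner => a; rewrite hornerM.
  by have [->|/PQ->] := eqVneq Q.[a] 0; rewrite ?mulr0 ?mul0r.
by rewrite mulf_eq0 (negbTE Q0) orbF => /eqP.
Qed.

Lemma horner_char_poly (p : nat) (A : 'M[R]_p) (a : R) :
  (char_poly A).[a] = \det (a%:M - A).
Proof.
rewrite /char_poly -[LHS]/(horner_eval a _) -det_map_mx; congr (\det _).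
by apply/matrixP => i j; rewrite !mxE /= /horner_eval hornerD hornerN hornerC hornerMn hornerX.
Qed.

(** W inverts the Vandermonde matrix of the nodes 0, ..., p. It presents the coefficients of the
    characteristic polynomial as fixed linear combinations of the determinants det(j - L), whose
    smoothness in the point is clear. *)
Lemma coef_interpolation (p : nat) : exists W : 'M[R]_p.+1,
  forall (P : {poly R}) (k : 'I_p.+1), (size P <= p.+1)%N ->
    P`_k = \sum_(j < p.+1) P.[j%:R] * W j k.
Proof.
pose a : 'rV[R]_p.+1 := \row_j j%:R.
have Vu : Vandermonde p.+1 a \in unitmx.
  rewrite unitmxE unitfE det_Vandermonde.
  apply/prodf_neq0 => i _; apply/prodf_neq0 => j ij.
  by rewrite !mxE subr_eq0 eqr_nat gtn_eqF.
exists (invmx (Vandermonde p.+1 a)) => P k sP.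
have := mulmxK Vu (\row_k P`_k) => /rowP/(_ k); rewrite [in RHS]mxE => <-.
rewrite mxE; apply: eq_bigr => j _; congr (_ * _).
rewrite mxE (horner_coef_wide _ sP); apply: eq_bigr => i _.
by rewrite !mxE.
Qed.

End PolynomialIdentity.

Section OperatorsA.
Context {R : realType} {n : nat}.
Local Notation X := 'cV[R]_n.+1.
Implicit Types (L : opfield R n) (x v : X).

(** The recursion of [opA] is Horner's scheme for the characteristic polynomial at L: step k has
    consumed its top k + 1 coefficients. The last step, k = n + 1, evaluates the whole polynomial
    and gives zero. *)
Lemma opA_horner L x k : (k <= n.+1)%N ->
  opA L k x = horner_mx (L x) (drop_poly (n.+1 - k) (char_poly (L x))).
Proof.
set chi := char_poly (L x).
have szchi : size chi = n.+2 := size_char_poly (L x).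
elim: k => [_|k IH kn].
  have -> : drop_poly (n.+1 - 0) chi = 1.
    apply/polyP => i; rewrite coef_drop_poly subn0 coef1.
    case: i => [|i] /=.
      by have /monicP := char_poly_monic (L x); rewrite lead_coefE size_char_poly.
    by rewrite nth_default // szchi addSn ltnS leq_addl.
  by rewrite rmorph1.
have -> : drop_poly (n.+1 - k.+1) chi = 'X * drop_poly (n.+1 - k) chi + (chi`_(n.+1 - k.+1))%:P.
  apply/polyP => i; rewrite coefD coefXM coefC !coef_drop_poly.
  case: i => [|i] /=; first by rewrite !add0n add0r.
  by rewrite addr0 subSS subSn // addSnnS.
rewrite rmorphD rmorphM /= horner_mx_X horner_mx_C -IH ?(ltnW kn) //.
by rewrite /sigma -/chi raddfN /= opprK.
Qed.

Lemma opA_Cayley_Hamilton L x : opA L n.+1 x = 0.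
Proof. by rewrite opA_horner // subnn drop_poly0l Cayley_Hamilton. Qed.

Lemma opA_comm L x (M : 'M[R]_n.+1) k :
  L x *m M = M *m L x -> opA L k x *m M = M *m opA L k x.
Proof.
move=> LM; elim: k => [|k IH] /=; first by rewrite mul1mx mulmx1.
by rewrite mulmxBl mulmxBr -mulmxA IH !mulmxA LM scalar_mxC.
Qed.

Lemma opA_commL L x k : opA L k x *m L x = L x *m opA L k x.
Proof. exact: opA_comm. Qed.

Lemma opA_commA L x j k : opA L j x *m opA L k x = opA L k x *m opA L j x.
Proof. by apply: opA_comm; rewrite opA_commL. Qed.

Lemma opAS L x k : L x *m opA L k x = opA L k.+1 x + (sigma L k.+1 x)%:M.
Proof. by rewrite /= subrK. Qed.

(** This is the resolvent description of the A_k. Multiplied by a - L, both sides become the scalar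
    matrix of the determinant, and this factor cancels when a is not an eigenvalue. *)
Lemma adj_char_mx L x (a : R) : (char_poly (L x)).[a] != 0 ->
  \adj (a%:M - L x) = \sum_(k < n.+1) a ^+ (n - k) *: opA L k x.
Proof.
move=> da; set S := \sum_(k < n.+1) _.
have du : a%:M - L x \in unitmx by rewrite unitmxE unitfE -horner_char_poly.
suff E : (a%:M - L x) *m S = (\det (a%:M - L x))%:M.
  by apply: (can_inj (mulKmx du)); rewrite E mul_mx_adj.
(* The partial sums telescope; the remainder a^(n+1-m) A_m disappears at m = n + 1 by
   Cayley-Hamilton. *)
have P m : (m <= n.+1)%N -> (a%:M - L x) *m \sum_(k < m) a ^+ (n - k) *: opA L k x =
    (a ^+ n.+1)%:M - a ^+ (n.+1 - m) *: opA L m x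
    - (\sum_(1 <= i < m.+1) sigma L i x * a ^+ (n.+1 - i))%:M.
  elim: m => [_|m IH mn].
    by rewrite big_ord0 mulmx0 big_geq // subn0 scalemx1 subrr raddf0 subr0.
  have := opAS L x m; move: (opA L m.+1 x) => B LA.
  rewrite big_ord_recr [in RHS]big_nat_recr //= mulmxDr (IH (ltnW mn)) -scalemxAr mulmxBl.
  rewrite mul_scalar_mx LA !subSS scalerBr scalerA -exprSr -subSn //.
  move: (opA L m x) (sigma L m.+1 x) (a ^+ n.+1) (\sum_(_ <= _ < _) _) (a ^+ (n.+1 - m)).
  by move=> *; mx_lincomb.
rewrite /S (P n.+1 (leqnn _)) opA_Cayley_Hamilton scaler0 subr0 -raddfB /=.
rewrite -horner_char_poly char_poly_sigma hornerD hornerN horner_sum hornerXn.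
by congr (_ - _)%:M; apply: eq_bigr => i _; rewrite hornerZ hornerXn.
Qed.

End OperatorsA.

(** * Jacobi's formula for the derivative of a determinant *)

Section Jacobi.
Context {R : realType} {V : normedModType R}.
Implicit Types (x v : V).

Lemma derive_prod (I : eqType) (r : seq I) (f : I -> V -> R) x v : uniq r ->
  (forall i, differentiable (f i) x) ->
  differentiable (fun y => \prod_(i <- r) f i y) x /\
  'D_v (fun y => \prod_(i <- r) f i y) x =
  \sum_(i <- r) 'D_v (f i) x * \prod_(j <- r | j != i) f j x.
Proof.
move=> ur df; elim: r ur => [_|i r IH /andP[ir ur]].
  rewrite (_ : (fun y => _) = cst 1); last by apply/funext => y; rewrite big_nil.
  by rewrite big_nil derive_cst; split=> //; exact: differentiable_cst.
have [dP DP] := IH ur.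
rewrite (_ : (fun y => _) = f i * (fun y => \prod_(i <- r) f i y)); last first.
  by apply/funext => y; rewrite big_cons.
split; first exact: differentiableM.
rewrite deriveM; [|exact: diff_derivable..].
rewrite DP big_cons big_cons eqxx /= addrC; congr (_ + _).
  rewrite [LHS]mulrC; congr (_ * _); rewrite [RHS]big_seq_cond [LHS]big_seq_cond.
  apply: eq_bigl => j; have [jr|//] := boolP (j \in r).
  by apply/esym; apply: contraNneq ir => <-.
rewrite [LHS]mulr_sumr; apply: eq_big_seq => k kr.
rewrite big_cons ifT; last by apply: contraNneq ir => ->.
by rewrite mulrCA.
Qed.

Lemma derive_det (p : nat) (M : V -> 'M[R]_p) x v : differentiable M x ->
  differentiable (fun y => \det (M y)) x /\
  'D_v (fun y => \det (M y)) x = \tr (\adj (M x) *m 'D_v M x).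
Proof.
move=> dM; have /differentiable_mxP eM := dM.
pose F (s : 'S_p) := (fun y => \prod_i M y i (s i)).
have FP s := derive_prod v (index_enum_uniq _) (fun i => eM i (s i)).
have dF (s : 'S_p) : differentiable ((-1) ^+ s *: F s) x.
  by apply: differentiableZ; have [] := FP s.
have E : (fun y => \det (M y)) = \sum_(s : 'S_p) (-1) ^+ s *: F s.
  by apply/funext => y; rewrite fct_sumE.
(* [N i] is M x with row i replaced by its derivative. Expanded along that row, its determinant is
   the i-th diagonal entry of ['D_v M x *m \adj (M x)]. *)
pose N (i : 'I_p) := \matrix_(a, b) (if a == i then ('D_v M x) a b else M x a b).
have NE i a b : N i a b = if a == i then ('D_v M x) a b else M x a b by rewrite mxE.
have detN i : \det (N i) = \sum_k ('D_v M x) i k * cofactor (M x) i k.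
  rewrite (expand_det_row _ i); apply: eq_bigr => k _; rewrite NE eqxx; congr (_ * _).
  congr (_ * \det _); apply/matrixP => a b; rewrite !mxE ifN //.
  by rewrite eq_sym neq_lift.
have D (s : {perm 'I_p}) : 'D_v ((-1) ^+ s *: F s) x =
    (-1) ^+ s * \sum_i ('D_v M x) i (s i) * \prod_(j | j != i) M x j (s j).
  have [dP DP] := FP s; rewrite deriveZ; last exact: diff_derivable.
  congr (_ * _); rewrite DP; apply: eq_bigr => i _.
  by rewrite derive_mxE.
have [dS DS] : differentiable (\sum_(s : 'S_p) (-1) ^+ s *: F s) x /\
    'D_v (\sum_(s : 'S_p) (-1) ^+ s *: F s) x = \sum_(s : 'S_p) 'D_v ((-1) ^+ s *: F s) x.
  apply: (big_rec2 (fun f d => differentiable f x /\ 'D_v f x = d)).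
    by split; [exact: differentiable_cst|exact: derive_cst].
  move=> s d f _ [df Df]; split; first exact: differentiableD (dF s) df.
  by rewrite deriveD; [rewrite Df|exact: diff_derivable (dF s)|exact: diff_derivable].
rewrite E; split; first exact: dS.
rewrite DS.
under eq_bigr do rewrite D mulr_sumr.
rewrite exchange_big /=; transitivity (\sum_i \det (N i)).
  apply: eq_bigr => i _; apply: eq_bigr => s _; congr (_ * _).
  rewrite [RHS](bigD1 i) //= NE eqxx; congr (_ * _); apply: eq_bigr => j ji.
  by rewrite NE (negbTE ji).
rewrite mxtrace_mulC; apply: eq_bigr => i _; rewrite detN mxE.
by apply: eq_bigr => k _; rewrite mxE.
Qed.

End Jacobi.

(** * The coefficients sigma_k as functions of the point *)

Section SigmaFields.
Context {R : realType} {n : nat}.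
Local Notation X := 'cV[R]_n.+1.
Implicit Types (U : set X) (L : opfield R n) (x u v : X).

Lemma smooth_mxB (p q : nat) U (A B : X -> 'M[R]_(p, q)) : open U ->
  smooth_on U A -> smooth_on U B -> smooth_on U (fun x => A x - B x).
Proof.
move=> oU sA sB; apply: smoothD => //.
by apply: smooth_eq (smooth_scalemx oU (smooth_cst U (-1 : R)) sB) => // x _; rewrite scaleN1r.
Qed.

Lemma smooth_coef_char_poly U L k : open U -> smooth_on U L -> (k <= n.+1)%N ->
  smooth_on U (fun x => (char_poly (L x))`_k).
Proof.
move=> oU sL kn.
have [W WE] := @coef_interpolation R n.+1.
have sd (a : R) : smooth_on U (fun x => \det (a%:M - L x)).
  by apply: smooth_det => //; apply: smooth_mxB => //; exact: smooth_cst.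
have : smooth_on U (fun x =>
    \sum_(j < n.+2) \det (j%:R%:M - L x) * W j (Ordinal (kn : (k < n.+2)%N))).
  by apply: smooth_sum => // j; apply: smoothM => //; exact: smooth_cst.
apply: smooth_eq => // x _.
rewrite -[k]/(nat_of_ord (Ordinal (kn : (k < n.+2)%N))) WE ?size_char_poly //.
by apply: eq_bigr => j _; rewrite horner_char_poly.
Qed.

Lemma smooth_sigma U L k : open U -> smooth_on U L -> smooth_on U (sigma L k).
Proof.
move=> oU sL.
have := smoothM oU (smooth_cst U (-1 : R)) (smooth_coef_char_poly oU sL (leq_subr k n.+1)).
by apply: smooth_eq => // x _; rewrite mulN1r.
Qed.

Lemma smooth_scalar U (f : X -> R) : open U -> smooth_on U f ->
  smooth_on U (fun x => (f x)%:M : 'M[R]_n.+1).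
Proof.
move=> oU sf.
apply: smooth_eq (smooth_scalemx oU sf (smooth_cst U (1%:M : 'M[R]_n.+1))) => // x _.
by rewrite scalemx1.
Qed.

Lemma smooth_opA U L k : open U -> smooth_on U L -> smooth_on U (opA L k).
Proof.
move=> oU sL; elim: k => [|k IH]; first exact: smooth_cst.
apply: smooth_mxB => //; first exact: smooth_mulmx.
by apply: smooth_scalar => //; exact: smooth_sigma.
Qed.

Lemma derive_sigma U L x v k : open U -> smooth_on U L -> U x -> (k <= n)%N ->
  'D_v (sigma L k.+1) x = \tr (opA L k x *m 'D_v L x).
Proof.
move=> oU sL Ux kn; have dL := smooth_diff sL Ux.
pose c i y := (char_poly (L y))`_i.
have dc (i : 'I_n.+2) : differentiable (c i) x.
  by apply: smooth_diff Ux; exact: smooth_coef_char_poly (ltn_ord i).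
pose t i := \tr (opA L i x *m 'D_v L x).
(* P is the derivative of the characteristic polynomial taken coefficientwise, and Q is the trace of
   ['D_v L x] against the adjugate of X - L. Jacobi's formula gives P + Q = 0 off the roots, hence
   identically; the claim is the coefficient of degree n - k. *)
pose P := \poly_(i < n.+2) ('D_v (c i) x).
pose Q := \poly_(i < n.+1) t (n - i)%N.
have PQ : P + Q = 0.
  apply: (poly0_cofinite (Q := char_poly (L x))); first by rewrite monic_neq0 ?char_poly_monic.
  move=> a chia; rewrite hornerD !horner_poly.
  have -> : \sum_(i < n.+2) 'D_v (c i) x * a ^+ i = 'D_v (fun y => \det (a%:M - L y)) x.
    have -> : (fun y => \det (a%:M - L y)) = \sum_(i < n.+2) a ^+ i *: c i.
      apply/funext => y; rewrite -horner_char_poly fct_sumE.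
      rewrite (@horner_coef_wide _ n.+2) ?size_char_poly //.
      by apply: eq_bigr => i _; rewrite mulrC.
    rewrite derive_sum; last by move=> i; apply/diff_derivable/differentiableZ.
    by apply: eq_bigr => i _; rewrite deriveZ 1?mulrC //; exact: diff_derivable.
  have dB : differentiable (fun y => a%:M - L y) x.
    by apply: differentiableB => //; exact: differentiable_cst.
  have [_ ->] := derive_det v dB.
  have -> : 'D_v (fun y => a%:M - L y) x = - 'D_v L x.
    rewrite [LHS]deriveB; [|exact: derivable_cst|exact: diff_derivable].
    by rewrite derive_cst sub0r.
  rewrite adj_char_mx // mulmxN -scaleN1r mxtraceZ mulN1r mulmx_suml.
  rewrite (big_morph _ (@mxtraceD _ _) (@mxtrace0 _ _)) addrC.
  apply/eqP; rewrite subr_eq0; apply/eqP.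
  rewrite (reindex_inj rev_ord_inj) /=; apply: eq_bigr => i _.
  have ni : (n - (n.+1 - i.+1))%N = i by rewrite subSS subKn // -ltnS.
  by rewrite ni subSS -scalemxAl mxtraceZ mulrC.
have := congr1 (fun p : {poly R} => p`_(n - k)%N) PQ.
rewrite coefD !coef_poly coef0 ltnS (leq_trans (leq_subr _ _)) // ltnS leq_subr subKn //.
move=> /eqP; rewrite addr_eq0 => /eqP E.
have -> : sigma L k.+1 = - c (n - k)%N by apply/funext => y; rewrite /sigma subSS.
rewrite deriveN ?E ?opprK //.
apply: diff_derivable; have kn2 : (n - k < n.+2)%N by rewrite ltnS (leq_trans (leq_subr _ _)).
exact: (dc (Ordinal kn2)).
Qed.

End SigmaFields.

(** * Traces of the Nijenhuis identity *)

Section NijenhuisTrace.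
Context {R : realType} {n : nat}.
Local Notation X := 'cV[R]_n.+1.
Implicit Types (U : set X) (L : opfield R n) (x u v : X).

(* Taking the trace of the Nijenhuis identity composed with an operator M that
   commutes with L kills the commutator term. *)
Lemma nijenhuis_trace (p : nat) (L M : 'M[R]_p) (l : {linear 'cV[R]_p -> 'M[R]_p})
    (v : 'cV[R]_p) :
  (forall u : 'cV_p, bracket_at L l L l v u = 0) -> L *m M = M *m L ->
  \tr (M *m l (L *m v)) = \tr (M *m L *m l v).
Proof.
move=> NL LM.
(* C is the endomorphism sending w to [l w *m v]. In terms of it the Nijenhuis identity reads l(L v)
   = L l(v) + C L - L C. *)
pose C := \matrix_(i, j) (l (delta_mx j 0) *m v) i 0.
have CE w : C *m w = l w *m v.
  have {2}-> : w = \sum_j w j 0 *: delta_mx j 0.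
    by rewrite [LHS]matrix_sum_delta; apply: eq_bigr => j _; rewrite big_ord1.
  rewrite linear_sum mulmx_suml; apply/colP => i.
  rewrite mxE summxE; apply: eq_bigr => j _.
  by rewrite linearZ /= -scalemxAl !mxE mulrC.
have E : l (L *m v) = L *m l v + C *m L - L *m C.
  apply/eqP; rewrite -subr_eq0; apply/eqP/matrixP => i j.
  have := NL (delta_mx j 0); rewrite /bracket_at -!CE !mulmxA.
  rewrite -!mulmxBl -mulmxDl -colE => /colP/(_ i); rewrite !mxE => H.
  by rewrite -[RHS]oppr0 -[in RHS]H; ring.
rewrite E mulmxBr mulmxDr raddfB raddfD /= !mulmxA.
have -> : \tr (M *m C *m L) = \tr (M *m L *m C).
  by rewrite mxtrace_mulC mulmxA LM.
by rewrite addrK.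
Qed.

Lemma nijenhuis_trace_opA (L : opfield R n) x (l : {linear X -> 'M[R]_n.+1}) v k :
  (forall u v, bracket_at (L x) l (L x) l u v = 0) ->
  \tr (opA L k x *m l v) = \tr (l (opA L k x *m v)).
Proof.
move=> NL.
(* M is generalized because each step of the recursion moves one factor L out of the argument of l
   and into M. *)
have T j M : L x *m M = M *m L x ->
    \tr (M *m opA L j x *m l v) = \tr (M *m l (opA L j x *m v)).
  elim: j M => [|j IH] M LM; first by rewrite /= mulmx1 mul1mx.
  rewrite /= mulmxBr mulmxBl mulmxBl raddfB linearB /= mulmxBr raddfB /=.
  congr (_ - _).
    rewrite -[L x *m opA L j x *m v]mulmxA (nijenhuis_trace (NL _) LM) mulmxA.
    by apply: IH; rewrite mulmxA LM.
  by rewrite mul_scalar_mx mul_mx_scalar linearZ /= -scalemxAl -scalemxAr.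
have := T k 1%:M; rewrite !mul1mx; apply.
by rewrite mulmx1.
Qed.

Lemma derive_sigma_opA U L x v k :
  open U -> smooth_on U L -> nijenhuis U L -> U x -> (k <= n)%N ->
  'D_v (sigma L k.+1) x = 'D_(opA L k x *m v) (sigma L 1) x.
Proof.
move=> oU sL NL Ux kn; have dL := smooth_diff sL Ux.
have lE : (fun w => 'D_w L x) = 'd L x by apply/funext => w; rewrite deriveE.
rewrite [LHS](derive_sigma v oU sL Ux kn).
rewrite [RHS](derive_sigma (opA L k x *m v) oU sL Ux (leq0n n)) mul1mx.
rewrite -[X in \tr (_ *m X) = _]/((fun w => 'D_w L x) v).
rewrite -[X in _ = \tr X]/((fun w => 'D_w L x) (opA L k x *m v)) lE.
apply: nijenhuis_trace_opA => u w.
by rewrite -lE; exact: nijenhuis_tensor Ux.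
Qed.

End NijenhuisTrace.

(** * Brackets among L and the operators A_k *)

Section OperatorsASymmetries.
Context {R : realType} {n : nat}.
Local Notation X := 'cV[R]_n.+1.
Implicit Types (U : set X) (L A : opfield R n) (x u v : X).

Lemma differentiable_opA U L k x : open U -> smooth_on U L -> U x ->
  differentiable (opA L k) x.
Proof. by move=> oU sL; apply: smooth_diff; exact: smooth_opA. Qed.

Lemma sym_tensor_opAS U L A x u v k : open U -> smooth_on U L -> U x ->
  differentiable A x -> A x *m L x = L x *m A x ->
  sym_tensor A (opA L k.+1) x u v =
  sym_tensor A L x u (opA L k x *m v) + L x *m sym_tensor A (opA L k) x u v
  - 'D_u (sigma L k.+1) x *: (A x *m v) + 'D_(A x *m u) (sigma L k.+1) x *: v.
Proof.
move=> oU sL Ux dA AL.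
have dL := smooth_diff sL Ux; have dk := differentiable_opA k oU sL Ux.
have ds := smooth_diff (smooth_sigma k.+1 oU sL) Ux.
pose f y := - sigma L k.+1 y.
have df : differentiable f x by exact: differentiableN.
have Df w : 'D_w f x = - 'D_w (sigma L k.+1) x.
  by rewrite [LHS]deriveN //; exact: diff_derivable.
have d1 : differentiable (fun y => f y *: (1%:M : 'M[R]_n.+1)) x.
  by apply: differentiable_scalemx => //; exact: differentiable_cst.
have -> : opA L k.+1 = fun y => L y *m opA L k y + f y *: 1%:M.
  apply/funext => y; rewrite /= scalemx1; congr (_ + _).
  by apply/matrixP => i j; rewrite /f !mxE [RHS]mulNrn.
have E (T1 T2 : X) a b (w1 w2 : X) :
    T1 + T2 + (- a *: w1 - - b *: w2) = T1 + T2 - a *: w1 + b *: w2 by mx_lincomb.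
apply: etrans (E _ _ _ _ _ _); rewrite -(sym_tensorM _ _ dL dk AL).
by rewrite -(sym_tensorZ1 _ _ dA df Df); exact: sym_tensorD (differentiable_mulmx dL dk) d1.
Qed.

Lemma sym_tensor_L_opA U L x u v k :
  open U -> smooth_on U L -> nijenhuis U L -> U x -> (k <= n.+1)%N ->
  sym_tensor L (opA L k) x u v =
  'D_(opA L k x *m u) (sigma L 1) x *: v - 'D_u (sigma L 1) x *: (opA L k x *m v).
Proof.
move=> oU sL NL Ux; have dL := smooth_diff sL Ux.
have ds := smooth_diff (smooth_sigma 1 oU sL) Ux.
elim: k => [_|k IH kn].
  by rewrite [LHS]sym_tensor1 /= !mul1mx subrr.
rewrite (sym_tensor_opAS _ _ _ oU sL Ux dL erefl) (nijenhuis_tensor _ _ sL NL Ux) add0r.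
rewrite (IH (ltnW kn)) !(derive_sigma_opA _ oU sL NL Ux kn).
rewrite mulmxA opA_commL mulmxBr -!scalemxAr.
have -> : opA L k.+1 x *m u = L x *m opA L k x *m u - sigma L k.+1 x *: u.
  by rewrite /= mulmxBl mul_scalar_mx.
have -> : opA L k.+1 x *m v = L x *m opA L k x *m v - sigma L k.+1 x *: v.
  by rewrite /= mulmxBl mul_scalar_mx.
rewrite (deriveDdir _ _ ds) (deriveNdir _ ds) (deriveZdir _ _ ds) !mulmxA.
move: ('D_(L x *m opA L k x *m u) _ x) ('D_u _ x) ('D_(opA L k x *m u) _ x) => a b c.
rewrite /GRing.scale /=; mx_lincomb.
Qed.

(** Writing A_(k+1) = L A_k - sigma_(k+1) Id, the value of <A_j, L>(v, A_k v) known from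
    [sym_tensor_L_opA] by antisymmetry cancels the two terms in d sigma_(k+1) = A_k^* theta. The
    cancellation uses that A_j and A_k commute, and takes place on the diagonal. *)
Lemma sym_tensor_opA U L x v j k :
  open U -> smooth_on U L -> nijenhuis U L -> U x -> (j <= n.+1)%N -> (k <= n.+1)%N ->
  sym_tensor (opA L j) (opA L k) x v v = 0.
Proof.
move=> oU sL NL Ux jn; have dj := differentiable_opA j oU sL Ux.
elim: k => [_|k IH kn]; first exact: sym_tensor1.
rewrite (sym_tensor_opAS _ _ _ oU sL Ux dj (opA_commL L x j)) (IH (ltnW kn)) mulmx0 addr0.
rewrite sym_tensorC (sym_tensor_L_opA _ _ oU sL NL Ux jn).
rewrite !(derive_sigma_opA _ oU sL NL Ux kn) !mulmxA (opA_commA L x j k).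
have E (a b : X) : - (a - b) - b + a = 0 by mx_lincomb.
exact: E.
Qed.

End OperatorsASymmetries.

(** * The Poincare lemma *)

Section IntegralWithParameter.
Context {R : realType}.
Local Notation mu := (@lebesgue_measure R).

(** Supplies the constant that dominates the integrand's derivative when differentiating under the
    integral sign. *)
Lemma compact_rectangle_bounded (psi : R * R -> R) (d : R) :
  (forall s t, `|s| <= d -> 0 <= t <= 1 -> {for (s, t), continuous psi}) ->
  exists2 M, 0 <= M & forall s t, `|s| <= d -> 0 <= t <= 1 -> `|psi (s, t)| <= M.
Proof.
move=> cpsi.
pose K : set (R * R) := `[- d, d] `*` `[0, 1].
have KE s t : `|s| <= d -> 0 <= t <= 1 -> K (s, t).
  by move=> sd t01; split; rewrite /= in_itv //= -ler_norml.
have cK : compact K by apply: compact_setX; exact: segment_compact.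
have cpK : {within K, continuous psi}.
  apply: continuous_in_subspaceT => -[s t]; rewrite inE => -[].
  by rewrite /= !in_itv /= -ler_norml; exact: cpsi.
have /compact_bounded [M [_ MP]] := continuous_compact cpK cK.
exists (`|M| + 1) => [|s t sd t01]; first by rewrite addr_ge0.
apply: (MP (`|M| + 1)); first by rewrite (le_lt_trans (ler_norm M)) // ltrDl.
by exists (s, t) => //; exact: KE.
Qed.

Lemma is_derive_integral (phi psi : R -> R -> R) (d : R) : 0 < d ->
  (forall s t : R, `|s| <= d -> 0 <= t <= 1 -> is_derive s 1 (phi ^~ t) (psi s t)) ->
  (forall s t : R, `|s| <= d -> 0 <= t <= 1 -> {for t, continuous (phi s)}) ->
  (forall s t : R, `|s| <= d -> 0 <= t <= 1 ->
     {for (s, t), continuous (fun z : R * R => psi z.1 z.2)}) ->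
  is_derive (0 : R) (1 : R) (fun s : R => \int[mu]_(t in `[0, 1]) phi s t)
    (\int[mu]_(t in `[0, 1]) psi 0 t).
Proof.
move=> d0 dphi cphi cpsi.
have [M M0 MP] := compact_rectangle_bounded cpsi.
have m01 : measurable (`[0, 1]%classic : set R) by exact: measurable_itv.
have I0 : `]- d, d[%classic (0 : R) by rewrite /= in_itv /= oppr_lt0 d0.
have Id (s : R) : `]- d, d[%classic s -> `|s| <= d.
  by rewrite /= in_itv /= => /andP[s1 s2]; rewrite ler_norml !ltW.
have intphi (s : R) : `]- d, d[%classic s -> mu.-integrable `[0, 1] (EFin \o phi s).
  move=> /Id sd; apply: continuous_compact_integrable; first exact: segment_compact.
  by apply: continuous_in_subspaceT => t; rewrite inE /= in_itv /=; exact: cphi.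
have derphi (s t : R) : `]- d, d[%classic s -> `[0, 1]%classic t -> derivable (phi ^~ t) s 1.
  by move=> /Id sd; rewrite /= in_itv /= => t01; have [] := dphi _ _ sd t01.
have d1 (s t : R) : `]- d, d[%classic s -> `[0, 1]%classic t -> partial1of2 phi s t = psi s t.
  move=> /Id sd; rewrite /= in_itv /= => t01; rewrite partial1of2E.
  by have [_ <-] := dphi _ _ sd t01.
have intM : mu.-integrable `[0, 1] (EFin \o (cst M : R -> R)).
  apply: continuous_compact_integrable; first exact: segment_compact.
  by apply: continuous_subspaceT => t; exact: cst_continuous.
have ub (s t : R) : `]- d, d[%classic s -> `[0, 1]%classic t -> `|partial1of2 phi s t| <= cst M t.
  move=> sI tI; rewrite d1 //; move: tI; rewrite /= in_itv /= => tI.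
  by apply: (MP s t) => //; exact: Id.
have cM0 (t : R) : 0 <= cst M t by [].
have D := @derivable_under_integral _ _ _ mu phi _ m01 0 (- d) d I0 intphi derphi
  (cst M) cM0 intM ub.
have E := @differentiation_under_integral _ _ _ mu phi _ m01 0 (- d) d I0 intphi derphi
  (cst M) cM0 intM ub.
apply: DeriveDef => //; rewrite -derive1E E.
by apply: eq_Rintegral => t; rewrite inE => t01; exact: d1.
Qed.

Lemma Rintegral_derivative (h h' : R -> R) :
  (forall t : R, 0 <= t <= 1 -> is_derive t 1 h (h' t)) ->
  (forall t : R, 0 <= t <= 1 -> {for t, continuous h'}) ->
  \int[mu]_(t in `[0, 1]) h' t = h 1 - h 0.
Proof.
move=> dh ch'.
have ch t : 0 <= t <= 1 -> {for t, continuous h}.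
  by move=> t01; apply/differentiable_continuous/derivable1_diffP; have [] := dh t t01.
rewrite /Rintegral (@continuous_FTC2 _ h' h) //.
- by apply: continuous_in_subspaceT => t; rewrite inE /= in_itv /=; exact: ch'.
- split.
  + move=> t; rewrite in_itv /= => /andP[t0 t1].
    by have [] := dh t; rewrite ?(ltW t0) ?(ltW t1).
  + by apply: cvg_at_right_filter; apply: ch; rewrite lexx ler01.
  + by apply: cvg_at_left_filter; apply: ch; rewrite lexx ler01.
- move=> t; rewrite in_itv /= => /andP[t0 t1].
  by rewrite derive1E; have [|_ ->] := dh t; rewrite ?(ltW t0) ?(ltW t1).
Qed.

End IntegralWithParameter.

(** * From directional derivatives to the differential *)

Section Gradient.
Context {R : realType} {n : nat}.
Local Notation X := 'cV[R]_n.+1.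

Lemma cvg_mulmx (T : Type) (F : set_system T) (p q r : nat)
    (A : T -> 'M[R]_(p, q)) (B : T -> 'M[R]_(q, r))
    (A0 : 'M[R]_(p, q)) (B0 : 'M[R]_(q, r)) : Filter F ->
  A y @[y --> F] --> A0 -> B y @[y --> F] --> B0 -> A y *m B y @[y --> F] --> A0 *m B0.
Proof.
move=> FF cA cB; apply: cvg_mx => i k.
have cAi j : A y i j @[y --> F] --> A0 i j.
  exact: (cvg_comp _ _ cA (@coord_continuous R p q i j A0)).
have cBi j : B y j k @[y --> F] --> B0 j k.
  exact: (cvg_comp _ _ cB (@coord_continuous R q r j k B0)).
have -> : (fun y => (A y *m B y) i k) = (fun y => \sum_j A y i j * B y j k).
  by apply/funext => y; rewrite mxE.
rewrite mxE; apply: cvg_big => [z|j _]; last exact: cvgM.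
  exact: add_continuous.
Qed.

Lemma norm_row_mul_col (a : 'rV[R]_n.+1) (v : X) : `|(a *m v) 0 0| <= n.+1%:R * `|a| * `|v|.
Proof.
have coord (p q : nat) (M : 'M[R]_(p, q)) i j : `|M i j| <= `|M|.
  rewrite [leRHS]/Num.Def.normr /= mx_normrE.
  exact: (le_bigmax _ (fun ij : 'I_p * 'I_q => `|M ij.1 ij.2|) (i, j)).
rewrite mxE; apply: le_trans (ler_norm_sum _ _ _) _.
apply: le_trans (_ : \sum_(j < n.+1) `|a| * `|v| <= _).
  by apply: ler_sum => j _; rewrite normrM ler_pM.
by rewrite sumr_const card_ord -mulrA mulr_natl.
Qed.

(** Differentiation under the integral only gives directional derivatives. When they depend
    continuously on the point, the mean value theorem on the segment from x to x + h turns the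
    remainder into (alpha(x + c h) - alpha(x)) h, which is small compared with h. *)
Lemma differentiable_gradient (U : set X) (g : X -> R) (alpha : oneform R n) x :
  open U -> U x -> {for x, continuous alpha} ->
  (forall y v, U y -> is_derive y v g ((alpha y *m v) 0 0)) -> differentiable g x.
Proof.
move=> oU Ux ca dg.
pose l : X -> R := fun y => (alpha x *m y) 0 0.
have dl0 : differentiable (fun y : X => alpha x *m y) x.
  by apply: differentiable_mulmx => //; exact: differentiable_cst.
have dl : differentiable l x by have /differentiable_mxP := dl0; exact.
have lE v : 'd l x v = l v.
  rewrite -deriveE // -(derive_mxE _ _ _ dl0) derive_mulmx //.
  by rewrite derive_cst mul0mx add0r derive_id.
have lc : continuous ('d l x) by exact: diff_continuous.
apply: (differentiable_approx lc) => eps eps0.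
(* The factor n + 1 is the one lost in [norm_row_mul_col], where both norms are maxima of
   coordinates. *)
pose e1 := eps / n.+1%:R; have e10 : 0 < e1 by rewrite divr_gt0.
have nU : nbhs x [set y | `|alpha x - alpha y| <= e1 /\ U y].
  apply: filterI; last exact: open_nbhs_nbhs.
  by move/cvgrPdist_le : ca => /(_ _ e10).
have /nbhs_ballP[d /= d0 dP] := nU.
apply/nbhs_ballP; exists d => //= h.
rewrite -ball_normE /ball_ /= sub0r normrN => hd.
have inU t : 0 <= t <= 1 -> `|alpha x - alpha (x + t *: h)| <= e1 /\ U (x + t *: h).
  move=> /andP[t0 t1]; apply: dP; rewrite -ball_normE /ball_ /= opprD addNKr normrN normrZ.
  by rewrite ger0_norm // (le_lt_trans _ hd) // ler_piMl.
have [t t01|c c01 E] := @MVT_line R n g x h 1 ltr01.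
  by have [_ /(dg _ h)[]] := inU t t01.
have [ac Uc] := inU c c01.
have -> : g (h + x) - (g x + 'd l x h) = ((alpha (x + c *: h) - alpha x) *m h) 0 0.
  rewrite lE [h + x]addrC.
  rewrite scale1r mul1r in E.
  have [_ E2] := dg (x + c *: h) h Uc.
  by rewrite opprD addrA E E2 mulmxBl [RHS]mxE [X in _ = _ + X]mxE.
apply: le_trans (norm_row_mul_col _ _) _; rewrite ler_wpM2r // distrC mulrC.
by rewrite -ler_pdivlMr.
Qed.

Lemma is_derive_along (W : normedModType R) (f : X -> W) (x u : X) (d : W) :
  is_derive (0 : R) (1 : R) (fun s : R => f (x + s *: u)) d -> is_derive x u f d.
Proof.
move=> [dl Dl].
have E : (fun h : R => h^-1 *: (((fun s : R => f (x + s *: u)) \o shift (0 : R)) (h *: (1 : R))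
            - f (x + (0 : R) *: u))) =
   (fun h => h^-1 *: ((f \o shift x) (h *: u) - f x)).
  apply/funext => h /=; rewrite scale0r addr0 addr0 [h *: 1]mulr1.
  by rewrite [x + _]addrC.
by apply: DeriveDef; [move: dl; rewrite /derivable E|rewrite -Dl /derive E].
Qed.

Lemma closed_form_sym (U : set X) (alpha : oneform R n) y v w :
  closed_form U alpha -> U y -> differentiable alpha y ->
  'D_w alpha y *m v = 'D_v alpha y *m w.
Proof.
move=> cl Uy da.
have E (a b : X) : 'D_a alpha y *m b =
    \sum_i \sum_j (a i 0 * b j 0 * 'D_(basis_vec i) (fun z => alpha z 0 j) y)%:M.
  have {1}-> : a = \sum_i a i 0 *: basis_vec i.
    by rewrite [LHS]matrix_sum_delta; apply: eq_bigr => j _; rewrite big_ord1.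
  rewrite deriveE // linear_sum mulmx_suml; apply: eq_bigr => i _.
  rewrite linearZ /= -deriveE //.
  apply/matrixP => k l; rewrite !ord1 summxE mxE; apply: eq_bigr => j _.
  by rewrite !mxE eqxx mulr1n (derive_mxE _ _ _ da) mulrAC.
rewrite !E exchange_big /=; apply: eq_bigr => i _; apply: eq_bigr => j _.
by rewrite (cl y Uy) [w _ _ * _]mulrC.
Qed.

End Gradient.

Section Poincare.
Context {R : realType} {n : nat}.
Local Notation X := 'cV[R]_n.+1.
Local Notation mu := (@lebesgue_measure R).

(** The line integral of alpha along the segment from p to x, that is, the homotopy operator of the
    Poincare lemma. *)
Definition radial_primitive (p : X) (alpha : oneform R n) (x : X) : R :=
  \int[mu]_(t in `[0, 1]) (alpha (p + t *: (x - p)) *m (x - p)) 0 0.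

(** Under the integral, closedness of alpha exchanges v and x - p in the derivative of alpha; the
    integrand is then the t-derivative of t alpha(p + t (x - p)) v, and only the boundary term at t
    = 1 survives. *)
Lemma is_derive_radial_primitive (p : X) (e : R) (alpha : oneform R n) x v :
  smooth_on (ball p e) alpha -> closed_form (ball p e) alpha -> ball p e x ->
  is_derive x v (radial_primitive p alpha) ((alpha x *m v) 0 0).
Proof.
move=> sa ca Vx.
have nx : nbhs x (ball p e).
  by apply: open_nbhs_nbhs; split=> //; exact: ball_open.
have /nbhs_ballP [r /= r0 rP] := nx.
have v0 : 0 < `|v| + 1 by rewrite ltr_wpDl.
pose d := r / 2 / (`|v| + 1).
(* This d keeps x + s v in the ball of radius r around x for all |s| <= d. The halving gives a
   strict inequality on the closed interval, whose compactness is used for the domination. *)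
have d0 : 0 < d by rewrite !divr_gt0.
have inV (s : R) : `|s| <= d -> ball p e (x + s *: v).
  move=> sd; apply: rP; rewrite -ball_normE /ball_ /= opprD addNKr normrN normrZ.
  rewrite (@le_lt_trans _ _ (d * (`|v| + 1))) //.
    by rewrite ler_pM // ler_wpDr.
  by rewrite /d divfK ?gt_eqF // ltr_pdivrMr // ltr_pMr // ltr1n.
pose w (s : R) : X := (x - p) + s *: v.
pose y (s t : R) : X := p + t *: w s.
have inVy (s t : R) : `|s| <= d -> 0 <= t <= 1 -> ball p e (y s t).
  move=> sd /andP[t0 t1].
  have : `|w s| < e.
    have := inV _ sd; rewrite -ball_normE /ball_ /= -normrN opprB.
    by rewrite /w addrAC.
  rewrite -ball_normE /ball_ /= /y opprD addNKr normrN normrZ ger0_norm //.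
  by apply: le_lt_trans; rewrite ler_piMl.
pose phi (s t : R) : R := (alpha (y s t) *m w s) 0 0.
pose psi (s t : R) : R := (t *: 'D_v alpha (y s t) *m w s + alpha (y s t) *m v) 0 0.
have da (s t : R) : `|s| <= d -> 0 <= t <= 1 -> differentiable alpha (y s t).
  by move=> sd t01; apply: smooth_diff sa _; exact: inVy.
have dDa (s t : R) : `|s| <= d -> 0 <= t <= 1 -> differentiable ('D_v alpha) (y s t).
  by move=> sd t01; apply: (smooth_diff (smooth_derive v sa)); exact: inVy.
have dphi (s t : R) : `|s| <= d -> 0 <= t <= 1 -> is_derive s (1 : R) (phi ^~ t) (psi s t).
  move=> sd t01.
  have yE s' : y s' t = (p + t *: (x - p)) + s' *: (t *: v).
    by rewrite /y /w scalerDr addrA !scalerA [s' * t]mulrC.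
  have das := da _ _ sd t01.
  have [A1 A2] : is_derive s (1 : R) (fun s' => alpha (y s' t)) (t *: 'D_v alpha (y s t)).
    rewrite -(deriveZdir _ _ das) yE.
    rewrite (_ : (fun s' => _) = (fun s' => alpha (p + t *: (x - p) + s' *: (t *: v)))).
      by apply: is_derive_line; rewrite -yE; exact: diff_derivable.
    by apply/funext => s'; rewrite yE.
  have [W1 W2] : is_derive s (1 : R) w v.
    by rewrite -[X in is_derive _ _ _ X](derive_id (x - p + s *: v)); exact: is_derive_line.
  have /derivable1_diffP dA := A1; have /derivable1_diffP dW := W1.
  have dM := differentiable_mulmx dA dW.
  apply: DeriveDef.
    by apply: diff_derivable; have /differentiable_mxP := dM; exact.
  rewrite -(derive_mxE _ _ _ dM) (derive_mulmx _ dA dW).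
  by rewrite A2 W2.
have cy (s t : R) : {for (s, t), continuous (fun z : R * R => y z.1 z.2)}.
  by apply: cvgD; [exact: cvg_cst|apply: cvgZ; [exact: cvg_snd|
    apply: cvgD; [exact: cvg_cst|apply: cvgZ; [exact: cvg_fst|exact: cvg_cst]]]].
have cw (s t : R) : {for (s, t), continuous (fun z : R * R => w z.1)}.
  by apply: cvgD; [exact: cvg_cst|apply: cvgZ; [exact: cvg_fst|exact: cvg_cst]].
have cay (s t : R) : `|s| <= d -> 0 <= t <= 1 ->
    {for (s, t), continuous (fun z : R * R => alpha (y z.1 z.2))}.
  move=> sd t01; apply: (cvg_comp _ _ (cy s t)).
  exact: (differentiable_continuous (da s t sd t01)).
have cDay (s t : R) : `|s| <= d -> 0 <= t <= 1 ->
    {for (s, t), continuous (fun z : R * R => 'D_v alpha (y z.1 z.2))}.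
  move=> sd t01; have := differentiable_continuous (dDa s t sd t01).
  exact: (@cvg_comp _ _ _ (fun z : R * R => y z.1 z.2) ('D_v alpha) _ _ _ (cy s t)).
have cpsi (s t : R) : `|s| <= d -> 0 <= t <= 1 ->
    {for (s, t), continuous (fun z : R * R => psi z.1 z.2)}.
  move=> sd t01.
  have c : (z.2 *: 'D_v alpha (y z.1 z.2) *m w z.1 + alpha (y z.1 z.2) *m v)
      @[z --> (s, t)] --> t *: 'D_v alpha (y s t) *m w s + alpha (y s t) *m v.
    apply: cvgD; apply: cvg_mulmx.
    - by apply: cvgZ; [exact: cvg_snd|exact: cDay].
    - exact: cw.
    - exact: cay.
    - exact: cvg_cst.
  exact: (cvg_comp _ _ c (@coord_continuous _ _ _ _ _ _)).
have cst2 (s t : R) : (s, t') @[t' --> t] --> (s, t).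
  exact: (@cvg_pair _ _ _ (nbhs t) (nbhs s) (nbhs t) _ _ _ (fun=> s) id (cvg_cst s) cvg_id).
have cphi (s t : R) : `|s| <= d -> 0 <= t <= 1 -> {for t, continuous (phi s)}.
  move=> sd t01.
  have c : alpha (y s t') *m w s @[t' --> t] --> alpha (y s t) *m w s.
    apply: cvg_mulmx; last exact: cvg_cst.
    exact: (cvg_comp _ _ (cst2 s t) (cay s t sd t01)).
  exact: (cvg_comp _ _ c (@coord_continuous _ _ _ _ _ _)).
apply: is_derive_along.
have -> : (fun s : R => radial_primitive p alpha (x + s *: v)) =
    (fun s => \int[mu]_(t in `[0, 1]) phi s t).
  by apply/funext => s; rewrite /radial_primitive /phi /y /w addrAC.
have -> : (alpha x *m v) 0 0 = \int[mu]_(t in `[0, 1]) psi 0 t.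
  pose h (t : R) : R := (t *: alpha (y 0 t) *m v) 0 0.
  have n0 : `|0 : R| <= d by rewrite normr0 ltW.
  have dh (t : R) : 0 <= t <= 1 -> is_derive t (1 : R) h (psi 0 t).
    move=> t01; have dat := da 0 t n0 t01.
    have [A1 A2] : is_derive t (1 : R) (fun t' => alpha (y 0 t')) ('D_(w 0) alpha (y 0 t)).
      by apply: is_derive_line; exact: diff_derivable.
    have /derivable1_diffP dA := A1.
    have did : differentiable (id : R -> R) t by [].
    have dS := differentiable_scalemx did dA.
    have dv := @differentiable_cst _ R X v t.
    have dM := differentiable_mulmx dS dv.
    apply: DeriveDef.
      by apply: diff_derivable; have /differentiable_mxP := dM; exact.
    rewrite -(derive_mxE _ _ _ dM) (derive_mulmx _ dS dv) (derive_scalemx _ did dA).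
    rewrite derive_cst mulmx0 addr0 derive_id scale1r A2 /psi mulmxDl addrC.
    by rewrite -!scalemxAl (closed_form_sym v (w 0) ca (inVy 0 t n0 t01) dat).
  have ch (t : R) : 0 <= t <= 1 -> {for t, continuous (psi 0)}.
    by move=> t01; exact: (cvg_comp _ _ (cst2 0 t) (cpsi 0 t n0 t01)).
  rewrite (Rintegral_derivative dh ch).
  rewrite /h scale0r mul0mx [X in _ = _ - X]mxE subr0 !scale1r /y /w scale0r addr0 scale1r.
  by rewrite addrC subrK.
exact: is_derive_integral d0 dphi cphi cpsi.
Qed.

Lemma poincare (p : X) (e : R) (alpha : oneform R n) :
  smooth_on (ball p e) alpha -> closed_form (ball p e) alpha ->
  exists2 g : X -> R, smooth_on (ball p e) g & forall x, ball p e x -> dfun g x = alpha x.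
Proof.
move=> sa ca; exists (radial_primitive p alpha) => [|x Vx]; last first.
  apply/rowP => j; rewrite mxE.
  have [_ ->] := is_derive_radial_primitive (basis_vec j) sa ca Vx.
  by rewrite -colE mxE.
have oV : open (ball p e) by exact: ball_open.
apply: smooth_primitive => [x Vx|v].
  apply: (@differentiable_gradient _ _ (ball p e) _ alpha) => //.
    by apply/differentiable_continuous; exact: smooth_diff sa Vx.
  by move=> y v Vy; exact: is_derive_radial_primitive Vy.
have /smooth_mxP sav := smooth_mulmx oV sa (smooth_cst (ball p e) v).
apply: smooth_eq (sav oV 0 0) => // x Vx.
by have [_ ->] := is_derive_radial_primitive v sa ca Vx.
Qed.

End Poincare.

(** * Cyclic vectors *)

Section CyclicVectors.
Context {R : realType} {n : nat}.
Local Notation X := 'cV[R]_n.+1.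
Implicit Types (l : 'M[R]_n.+1) (u v : X) (L : opfield R n).

(** Linear independence of v, l v, ..., l^n v, stated through polynomials so that it applies equally
    to the powers of l and to the A_k, which are other polynomials in l. *)
Definition cyclic_vec l v := forall q : {poly R},
  (size q <= n.+1)%N -> horner_mx l q *m v = 0 -> q = 0.

Definition krylov l v := \matrix_(k < n.+1) (l ^+ k *m v)^T.

Lemma horner_mx_sum l (c : 'I_n.+1 -> R) :
  horner_mx l (\sum_(k < n.+1) c k *: 'X^k) = \sum_(k < n.+1) c k *: l ^+ k.
Proof.
rewrite linear_sum; apply: eq_bigr => k _.
by rewrite linearZ /= rmorphXn /= horner_mx_X.
Qed.

Lemma cyclic_vec_free l v (c : 'I_n.+1 -> R) : cyclic_vec l v ->
  \sum_(k < n.+1) c k *: (l ^+ k *m v) = 0 -> forall k, c k = 0.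
Proof.
move=> cv c0 k; pose q := \sum_(k < n.+1) c k *: 'X^k.
have qE : q = \poly_(i < n.+1) c (inord i).
  by rewrite poly_def; apply: eq_bigr => i _; rewrite inord_val.
have : q = 0.
  apply: cv; first by rewrite qE size_poly.
  rewrite horner_mx_sum mulmx_suml -[RHS]c0. by apply: eq_bigr => i _; rewrite scalemxAl.
by move/(congr1 (fun p : {poly R} => p`_k)); rewrite qE coef_poly ltn_ord inord_val coef0.
Qed.

Lemma krylov_mul l v (c : 'rV[R]_n.+1) :
  c *m krylov l v = (\sum_(k < n.+1) c 0 k *: (l ^+ k *m v))^T.
Proof.
apply/rowP => j; rewrite [RHS]mxE summxE mxE; apply: eq_bigr => k _.
by rewrite !mxE.
Qed.

Lemma krylovD l u v (t : R) : krylov l (v + t *: u) = krylov l v + t *: krylov l u.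
Proof.
by apply/matrixP => i j; rewrite [LHS]mxE mulmxDr -scalemxAr linearD linearZ /= !mxE.
Qed.

Lemma cyclic_vecP l v : cyclic_vec l v <-> krylov l v \in unitmx.
Proof.
split=> [cv|Ku q sq q0].
  rewrite -row_free_unit; apply: inj_row_free => c; rewrite krylov_mul => /(congr1 trmx).
  rewrite trmxK trmx0 => c0; apply/rowP => k; rewrite mxE.
  exact: (cyclic_vec_free (c := fun k => c 0 k) cv c0).
pose c : 'rV[R]_n.+1 := \row_k q`_k.
have qE : q = \sum_(k < n.+1) c 0 k *: 'X^k.
  rewrite -[LHS]coefK poly_def (big_ord_widen_cond _ xpredT (fun i => q`_i *: 'X^i) sq).
  rewrite big_mkcond; apply: eq_bigr => k _; rewrite mxE; case: ifP => //= /negbT.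
  by rewrite -leqNgt => sk; rewrite nth_default // scale0r.
have E : horner_mx l q *m v = \sum_(k < n.+1) c 0 k *: (l ^+ k *m v).
  rewrite qE horner_mx_sum mulmx_suml.
  by apply: eq_bigr => i _; rewrite scalemxAl.
have : c *m krylov l v = 0 by rewrite krylov_mul -E q0 trmx0.
move=> cK; have c0 : c = 0 by rewrite -(mulmxK Ku c) cK mul0mx.
by rewrite qE c0 big1 // => i _; rewrite mxE scale0r.
Qed.

Lemma gl_regular_cyclic (U : set X) L x : gl_regular U L -> U x ->
  exists v, cyclic_vec (L x) v.
Proof.
move=> rL Ux; have [v fv] := rL x Ux; exists v; apply/cyclic_vecP.
rewrite -row_free_unit; apply: inj_row_free => c; rewrite krylov_mul => /(congr1 trmx).
rewrite trmxK trmx0 => c0; apply/rowP => k; rewrite mxE.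
pose s := map_tuple (fun k => L x ^+ k *m v) (iota_tuple n.+1 0).
have /freeP : free s by exact: fv.
apply; rewrite -[RHS]c0; apply: eq_bigr => i _; congr (_ *: _).
by rewrite (nth_map 0%N) ?size_iota // nth_iota.
Qed.

(* The determinant of [krylov l (v + t u)] is a polynomial in t, nonzero at 0. *)
Lemma cyclic_vec_dense l v (w : 'rV[R]_n.+1) : cyclic_vec l v ->
  (forall u, cyclic_vec l u -> w *m u = 0) -> w = 0.
Proof.
move=> cv w0; suff wu u : w *m u = 0.
  by apply/rowP => j; have := wu (delta_mx j 0); rewrite -colE => /colP/(_ 0); rewrite !mxE.
pose P := \det (map_mx polyC (krylov l v) + 'X *: map_mx polyC (krylov l u)).
have PE t : P.[t] = \det (krylov l (v + t *: u)).
  rewrite /P -[LHS]/(horner_eval t _) -det_map_mx; congr (\det _).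
  rewrite krylovD; move: (krylov l v) (krylov l u) => K1 K2.
  by apply/matrixP => i j; rewrite !mxE /= /horner_eval hornerD hornerM !hornerC hornerX.
have P0 : P.[0] != 0.
  by rewrite PE scale0r addr0; move/cyclic_vecP: cv; rewrite unitmxE unitfE.
(* The factor ['X] absorbs t = 0, where the vanishing of w on v + t u says nothing about u. *)
have : P * 'X != 0.
  rewrite mulf_neq0 ?polyX_eq0 //; apply: contraNneq P0 => ->; by rewrite horner0.
apply: contraNeq => wu0; apply/eqP; apply: poly0_horner => t.
rewrite hornerM hornerX; have [->|Pt] := eqVneq P.[t] 0; first by rewrite mul0r.
have cvt : cyclic_vec l (v + t *: u) by apply/cyclic_vecP; rewrite unitmxE unitfE -PE.
have /eqP := w0 _ cvt; rewrite mulmxDr (w0 _ cv) add0r -scalemxAr scalemx_eq0 (negbTE wu0) orbF.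
by move=> /eqP ->; rewrite mulr0.
Qed.

(** A_k is a monic polynomial of degree k in L, so the family is triangular with respect to the
    powers of L, and the coefficients vanish one after the other from the top degree down. *)
Lemma opA_free L x v (c : 'I_n.+1 -> R) : cyclic_vec (L x) v ->
  \sum_(k < n.+1) c k *: (opA L k x *m v) = 0 -> forall k, c k = 0.
Proof.
move=> cv c0.
pose a k := drop_poly (n.+1 - k) (char_poly (L x)).
have sa k : (k <= n)%N -> size (a k) = k.+1.
  move=> kn; rewrite size_drop_poly size_char_poly subSn ?leq_subr // subKn //.
  exact: leqW.
have q0 : \sum_(k < n.+1) c k *: a k = 0.
  apply: cv.
    apply: (big_ind (fun q : {poly R} => (size q <= n.+1)%N)) => [|p q sp sq|k _].
    - by rewrite size_poly0.
    - by rewrite (leq_trans (size_polyD _ _)) // geq_max sp.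
    - by rewrite (leq_trans (size_scale_leq _ _)) // sa // -ltnS.
  rewrite linear_sum mulmx_suml -[RHS]c0; apply: eq_bigr => k _.
  by rewrite linearZ /= -scalemxAl opA_horner // ltnW.
have T m : (m <= n.+1)%N -> \sum_(k < n.+1 | (k < m)%N) c k *: a k = 0 ->
    forall k : 'I_n.+1, (k < m)%N -> c k = 0.
  elim: m => [//|m IH mn s0].
  pose m' := Ordinal mn.
  have lt_m (k : 'I_n.+1) : (k < m.+1)%N && (k != m') = (k < m)%N.
    by rewrite ltnS [RHS]ltn_neqAle andbC -(inj_eq val_inj).
  have am : (a m)`_m = 1.
    rewrite coef_drop_poly subnKC; last exact: leqW.
    by have /monicP := char_poly_monic (L x); rewrite lead_coefE size_char_poly.
  have cm : c m' = 0.
    have := congr1 (fun p : {poly R} => p`_m) s0; rewrite coef0 => <-.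
    rewrite coef_sum (bigD1 m') //= coefZ am mulr1 big1 ?addr0 // => k.
    rewrite lt_m => km; rewrite coefZ nth_default ?mulr0 // sa //.
    by rewrite -ltnS.
  have : \sum_(k < n.+1 | (k < m)%N) c k *: a k = 0.
    rewrite -[RHS]s0 [RHS](bigD1 m') //= cm scale0r add0r; apply: eq_bigl => k.
    by rewrite lt_m.
  move=> /(IH (ltnW mn)) ck k; rewrite ltnS leq_eqVlt => /predU1P[km|/ck //].
  by rewrite (_ : k = m') //; exact: val_inj.
move=> k; apply: (T n.+1) => //; rewrite -[RHS]q0; apply: eq_bigl => i.
by rewrite ltn_ord.
Qed.

End CyclicVectors.

(** * Two expansions of the Bezoutian of the characteristic polynomial *)

Section Convolutions.
Context {R : realType} {n : nat}.
Local Notation X := 'cV[R]_n.+1.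
Implicit Types (L : opfield R n) (x u v : X) (K : 'M[R]_n.+1).

(* Let X and Y act on K by multiplication by L on the right and on the left.
   In this lemma and the next one the sum is (A_m(X) - A_m(Y)) / (X - Y)
   applied to K. *)
Lemma commutator_opA_pow L x K m :
  L x *m (\sum_(i < m.+1) opA L (m - i) x *m K *m L x ^+ i)
  - (\sum_(i < m.+1) opA L (m - i) x *m K *m L x ^+ i) *m L x =
  opA L m.+1 x *m K - K *m opA L m.+1 x.
Proof.
have base k (Q : 'M[R]_n.+1) : L x *m Q - Q *m L x = opA L k x *m K - K *m opA L k x ->
   L x *m (opA L k x *m K + Q *m L x) - (opA L k x *m K + Q *m L x) *m L x =
   opA L k.+1 x *m K - K *m opA L k.+1 x.
  move=> H.
  have -> : L x *m (opA L k x *m K + Q *m L x) - (opA L k x *m K + Q *m L x) *m L x =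
     L x *m opA L k x *m K - opA L k x *m K *m L x + (L x *m Q - Q *m L x) *m L x.
    by rewrite mulmxDr mulmxDl mulmxBl !mulmxA; mx_lincomb.
  rewrite H /= !mulmxBl !mulmxBr -!mulmxA opA_commL !mulmxA mul_scalar_mx mul_mx_scalar.
  by mx_lincomb.
elim: m => [|m IH].
  have B : L x *m 0 - 0 *m L x = opA L 0 x *m K - K *m opA L 0 x.
    by rewrite mulmx0 mul0mx /= mul1mx mulmx1 !subrr.
  by have := base 0%N 0 B; rewrite big_ord1 subnn expr0 mulmx1 mul0mx addr0.
rewrite big_ord_recl subn0 expr0 mulmx1.
rewrite (_ : \sum_(i < m.+1) _ = (\sum_(i < m.+1) opA L (m - i) x *m K *m L x ^+ i) *m L x).
  exact: base IH.
rewrite mulmx_suml; apply: eq_bigr => i _.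
by rewrite lift0 subSS exprSr -[RHS]mulmxA.
Qed.

Lemma commutator_pow_opA L x K m :
  L x *m (\sum_(i < m) L x ^+ (m.-1 - i) *m K *m opA L i x)
  - (\sum_(i < m) L x ^+ (m.-1 - i) *m K *m opA L i x) *m L x =
  opA L m x *m K - K *m opA L m x.
Proof.
elim: m => [|m IH]; first by rewrite big_ord0 mulmx0 mul0mx /= mul1mx mulmx1 !subrr.
rewrite big_ord_recr /= subnn expr0 mul1mx.
set P := \sum_(i < m) _ in IH; rewrite (_ : \sum_(i < m) _ = L x *m P); last first.
  rewrite mulmx_sumr; apply: eq_bigr => i _; rewrite !mulmxA; congr (_ *m _ *m _).
  have m0 : (0 < m)%N by apply: leq_ltn_trans (ltn_ord i).
  rewrite -[L x *m _]exprS; congr (_ ^+ _).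
  by rewrite -subSn ?prednK // -ltnS prednK.
have -> : L x *m (L x *m P + K *m opA L m x) - (L x *m P + K *m opA L m x) *m L x =
     L x *m (L x *m P - P *m L x) + L x *m K *m opA L m x - K *m (opA L m x *m L x).
  by rewrite mulmxDr mulmxDl mulmxBr !mulmxA; mx_lincomb.
rewrite IH opA_commL /= !mulmxBr !mulmxBl !mulmxA mul_scalar_mx mul_mx_scalar.
by mx_lincomb.
Qed.

End Convolutions.

(** * Differentials, and brackets of combinations with function coefficients *)

Section Differentials.
Context {R : realType} {n : nat}.
Local Notation X := 'cV[R]_n.+1.
Implicit Types (U : set X) (h : X -> R) (L : opfield R n) (x u v w : X).

Lemma dfun_mul h x v : differentiable h x -> dfun h x *m v = ('D_v h x)%:M.
Proof.
move=> dh.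
have {2}-> : v = \sum_i v i 0 *: basis_vec i.
  by rewrite [LHS]matrix_sum_delta; apply: eq_bigr => j _; rewrite big_ord1.
apply/matrixP => i j; rewrite !ord1 [RHS]mxE eqxx mulr1n deriveE // linear_sum mxE.
apply: eq_bigr => k _.
by rewrite linearZ /= -deriveE // mxE mulrC.
Qed.

(** As a matrix product, the term lets v and the differential be regrouped into a rank-one operator,
    the K of the commutator identities. *)
Lemma scale_derive h x v w : differentiable h x -> 'D_v h x *: w = w *m (dfun h x *m v).
Proof. by move=> dh; rewrite (dfun_mul v dh) mul_mx_scalar. Qed.

Lemma smooth_dfun U h : open U -> smooth_on U h -> smooth_on U (dfun h).
Proof.
move=> oU sh; apply/smooth_mxP => // i j.
by apply: smooth_eq (smooth_derive (basis_vec j) sh) => // x _; rewrite mxE.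
Qed.

Lemma closed_dfun U h : open U -> smooth_on U h -> closed_form U (dfun h).
Proof.
move=> oU sh x Ux i j.
have E k : (fun y => dfun h y 0 k) = 'D_(basis_vec k) h.
  by apply/funext => y; rewrite mxE.
by rewrite !E; exact: derive_comm oU (sh 2) Ux.
Qed.

Lemma closed_form_eq U (alpha beta : oneform R n) : open U ->
  (forall x, U x -> alpha x = beta x) -> closed_form U alpha -> closed_form U beta.
Proof.
move=> oU ab ca x Ux i j.
have nab : \near x, alpha x = beta x.
  by have nU : nbhs x U by [exact: open_nbhs_nbhs]; exact: filterS nU.
have E k : 'D_(basis_vec k) (fun y => beta y 0 j) x = 'D_(basis_vec k) (fun y => alpha y 0 j) x.
  by apply: near_eq_derive; apply: filterS nab => y ->.
have E' k : 'D_(basis_vec k) (fun y => beta y 0 i) x = 'D_(basis_vec k) (fun y => alpha y 0 i) x.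
  by apply: near_eq_derive; apply: filterS nab => y ->.
by rewrite E E'; exact: ca.
Qed.

Lemma sym_tensor_eq U A M M' x u v : open U -> U x ->
  (forall y, U y -> M y = M' y) ->
  sym_tensor A M x u v = sym_tensor A M' x u v.
Proof.
move=> oU Ux MM'.
have nM : \near x, M x = M' x.
  by have nU : nbhs x U by [exact: open_nbhs_nbhs]; exact: filterS nU.
rewrite /sym_tensor (MM' x Ux).
have -> // : (fun w => 'D_w M x) = (fun w => 'D_w M' x).
by apply/funext => w; exact: near_eq_derive.
Qed.

Lemma sym_tensor_pow U L x u v k : open U -> smooth_on U L -> nijenhuis U L -> U x ->
  sym_tensor L (fun y => L y ^+ k) x u v = 0.
Proof.
move=> oU sL NL Ux; have dL := smooth_diff sL Ux.
elim: k => [|k IH] in v *; first exact: sym_tensor1.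
have dk := smooth_diff (smooth_expmx k oU sL) Ux.
rewrite (_ : (fun y => _) = (fun y => L y *m L y ^+ k)); last first.
  by apply/funext => y; rewrite exprS.
by rewrite (sym_tensorM _ _ dL dk erefl) IH mulmx0 addr0; exact: nijenhuis_tensor Ux.
Qed.

Lemma smooth_opB U L f : open U -> smooth_on U L -> (forall i, smooth_on U (f i)) ->
  smooth_on U (opB L f).
Proof.
move=> oU sL sf; apply: smooth_sum => // i.
by apply: smooth_scalemx => //; exact: smooth_opA.
Qed.

Lemma smooth_op_poly U L g : open U -> smooth_on U L -> (forall i, smooth_on U (g i)) ->
  smooth_on U (op_poly L g).
Proof.
move=> oU sL sg; apply: smooth_sum => // i.
by apply: smooth_scalemx => //; exact: smooth_expmx.
Qed.

Lemma sym_tensor_opB U L f x v j : open U -> smooth_on U L -> nijenhuis U L -> U x ->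
  (forall i, differentiable (f i) x) -> (j <= n.+1)%N ->
  sym_tensor (opA L j) (opB L f) x v v =
  \sum_(i < n.+1) ('D_v (f i) x *: (opA L j x *m opA L (n - i) x *m v)
    - 'D_(opA L j x *m v) (f i) x *: (opA L (n - i) x *m v)).
Proof.
move=> oU sL NL Ux df jn.
have dA k := differentiable_opA k oU sL Ux.
rewrite sym_tensor_sum => [|//|i]; last exact: differentiable_scalemx.
apply: eq_bigr => i _; rewrite (sym_tensorZ _ _ (dA j) (df i) (dA _) (fun=> erefl)).
by rewrite (sym_tensor_opA _ oU sL NL Ux jn) ?scaler0 ?add0r // ltnW // ltnS leq_subr.
Qed.

Lemma sym_tensor_op_poly U L g x v : open U -> smooth_on U L -> nijenhuis U L -> U x ->
  (forall i, differentiable (g i) x) ->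
  sym_tensor L (op_poly L g) x v v =
  \sum_(i < n.+1) ('D_v (g i) x *: (L x *m L x ^+ (n - i) *m v)
    - 'D_(L x *m v) (g i) x *: (L x ^+ (n - i) *m v)).
Proof.
move=> oU sL NL Ux dg.
have dL := smooth_diff sL Ux.
have dk k := smooth_diff (smooth_expmx k oU sL) Ux.
rewrite sym_tensor_sum => [|//|i]; last exact: differentiable_scalemx.
apply: eq_bigr => i _; rewrite (sym_tensorZ _ _ dL (dg i) (dk _) (fun=> erefl)).
by rewrite (sym_tensor_pow _ _ _ oU sL NL Ux) scaler0 add0r.
Qed.

End Differentials.

(** * Reading off coefficients with a cyclic vector *)

Section Coefficients.
Context {R : realType} {n : nat}.
Local Notation X := 'cV[R]_n.+1.
Implicit Types (U : set X) (L : opfield R n) (x u v : X).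

Lemma opA_recurrence L x u (a b : nat -> R) : cyclic_vec (L x) u ->
  \sum_(i < n.+1) (a i *: (L x *m opA L (n - i) x *m u) - b i *: (opA L (n - i) x *m u)) = 0 ->
  forall i, (i < n)%N -> a i.+1 = b i.
Proof.
move=> cu s0.
(* [d i] is the coefficient of A_(n-i) u once L A_k is replaced by A_(k+1) + sigma_(k+1) Id. The
   index shifts by one, the term in a 0 drops since A_(n+1) = 0, and all the sigma terms multiply
   A_0, so s appears at i = n only. *)
pose s := \sum_(i < n.+1) a i * sigma L (n - i).+1 x.
pose d i := (if (i < n)%N then a i.+1 else s) - b i.
have E : \sum_(i < n.+1) d i *: (opA L (n - i) x *m u) = 0.
  rewrite -[RHS]s0 sumrB.
  under [X in _ = X - _]eq_bigr => i _.
    rewrite opAS mulmxDl scalerDr mul_scalar_mx scalerA; over.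
  rewrite big_split /= -scaler_suml -/s [X in _ = X + _ - _]big_ord_recl /=.
  rewrite subn0 -/(opA L n.+1 x) opA_Cayley_Hamilton mul0mx scaler0 add0r.
  rewrite [X in _ = _ - X]big_ord_recr [LHS]big_ord_recr /= subnn mul1mx.
  rewrite /d ltnn scalerBl opprD addrACA -sumrB; congr (_ + _).
  apply: eq_bigr => i _; rewrite /bump /= add1n ltn_ord scalerBl.
  by rewrite -[X in _ = _ *: (X *m u) - _]/(opA L (n - i.+1).+1 x) subnSK.
have d0 : \sum_(k < n.+1) d (n - k)%N *: (opA L k x *m u) = 0.
  rewrite -[RHS]E (reindex_inj rev_ord_inj) /=; apply: eq_bigr => k _.
  by rewrite !subSS subKn // -ltnS.
move=> i lin; have ri : (n - i < n.+1)%N by rewrite ltnS leq_subr.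
have := opA_free (c := fun k : 'I_n.+1 => d (n - k)%N) cu d0 (Ordinal ri).
rewrite /= subKn 1?ltnW // /d lin => /eqP; rewrite subr_eq0 => /eqP.
exact.
Qed.

Lemma pow_Cayley_Hamilton L x :
  L x *m L x ^+ n = \sum_(i < n.+1) sigma L i.+1 x *: L x ^+ (n - i).
Proof.
have := Cayley_Hamilton (L x); rewrite char_poly_sigma linearB /= rmorphXn /= horner_mx_X.
move/eqP; rewrite subr_eq0 -[L x *m _]exprS => /eqP ->.
rewrite linear_sum big_add1 big_mkord; apply: eq_bigr => i _.
by rewrite linearZ /= rmorphXn /= horner_mx_X subSS.
Qed.

(** Only L^(n+1) has to be reduced, and Cayley-Hamilton spreads its coefficient a 0 over all powers.
    The resulting sigma term reproduces the recursion that defines the A_k. *)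
Lemma pow_recurrence L x u (a b : nat -> R) : cyclic_vec (L x) u ->
  \sum_(i < n.+1) (a i *: (L x *m L x ^+ (n - i) *m u) - b i *: (L x ^+ (n - i) *m u)) = 0 ->
  forall i, (i < n)%N -> a i.+1 = b i - a 0 * sigma L i.+1 x.
Proof.
move=> cu s0.
pose d i := (if (i < n)%N then a i.+1 else 0) + a 0 * sigma L i.+1 x - b i.
have E : \sum_(i < n.+1) d i *: (L x ^+ (n - i) *m u) = 0.
  rewrite -[RHS]s0 sumrB [X in _ = X - _]big_ord_recl /= subn0.
  rewrite pow_Cayley_Hamilton mulmx_suml scaler_sumr.
  under eq_bigr => i _ do rewrite /d scalerBl scalerDl.
  rewrite sumrB; congr (_ - _); rewrite big_split /= addrC; congr (_ + _).
    by apply: eq_bigr => i _; rewrite -scalemxAl scalerA.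
  rewrite big_ord_recr /= ltnn scale0r addr0; apply: eq_bigr => i _.
  by rewrite ltn_ord /bump /= add1n -[L x *m _]exprS subnSK.
have d0 : \sum_(k < n.+1) d (n - k)%N *: (L x ^+ k *m u) = 0.
  rewrite -[RHS]E (reindex_inj rev_ord_inj) /=; apply: eq_bigr => k _.
  by rewrite !subSS subKn // -ltnS.
move=> i lin; have ri : (n - i < n.+1)%N by rewrite ltnS leq_subr.
have := cyclic_vec_free (c := fun k : 'I_n.+1 => d (n - k)%N) cu d0 (Ordinal ri).
rewrite /= subKn 1?ltnW // /d lin => /eqP; rewrite subr_eq0 => /eqP <-.
by rewrite addrK.
Qed.

Definition opA_frame L x v := \matrix_(i < n.+1) (opA L (n - i) x *m v)^T.

Lemma opA_frame_mul L x v (c : 'rV[R]_n.+1) :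
  c *m opA_frame L x v = ((\sum_(i < n.+1) c 0 i *: opA L (n - i) x) *m v)^T.
Proof.
apply/rowP => j; rewrite mulmx_suml [RHS]mxE summxE mxE; apply: eq_bigr => k _.
by rewrite -scalemxAl !mxE.
Qed.

Lemma opA_frame_unit L x v : cyclic_vec (L x) v -> opA_frame L x v \in unitmx.
Proof.
move=> cv; rewrite -row_free_unit; apply: inj_row_free => c.
rewrite opA_frame_mul => /(congr1 trmx); rewrite trmxK trmx0 mulmx_suml => c0.
have H := opA_free (c := fun k : 'I_n.+1 => c 0 (rev_ord k)) cv.
apply/rowP => k; rewrite mxE -[k]rev_ordK; apply: H.
rewrite -[RHS]c0 (reindex_inj rev_ord_inj) /=; apply: eq_bigr => i _.
by rewrite rev_ordK subSS scalemxAl.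
Qed.

Lemma comm_cyclic_eq (l M M' : 'M[R]_n.+1) v : cyclic_vec l v ->
  l *m M = M *m l -> l *m M' = M' *m l -> M *m v = M' *m v -> M = M'.
Proof.
move=> /cyclic_vecP Ku lM lM' Mv.
have pc k (P : 'M[R]_n.+1) : l *m P = P *m l -> l ^+ k *m P = P *m l ^+ k.
  move=> lP; elim: k => [|k IH]; first by rewrite expr0 mul1mx mulmx1.
  by rewrite exprS -[l * _]/(l *m _) -mulmxA IH !mulmxA lP.
apply: trmx_inj; apply: (can_inj (mulKmx Ku)); apply/row_matrixP => k.
by rewrite !row_mul !rowK -!trmx_mul !mulmxA -!pc // -!mulmxA Mv.
Qed.

Lemma comm_opA_coef L x v (B : 'M[R]_n.+1) : cyclic_vec (L x) v ->
  L x *m B = B *m L x ->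
  B = \sum_(i < n.+1) ((B *m v)^T *m invmx (opA_frame L x v)) 0 i *: opA L (n - i) x.
Proof.
move=> cv LB; apply: (comm_cyclic_eq cv LB).
  rewrite mulmx_sumr mulmx_suml; apply: eq_bigr => i _.
  by rewrite -scalemxAr -scalemxAl opA_commL.
apply: trmx_inj; rewrite -opA_frame_mul mulmxKV //; exact: opA_frame_unit.
Qed.

Lemma opA_coef_unique L x v (c : 'rV[R]_n.+1) : opA_frame L x v \in unitmx ->
  ((\sum_(i < n.+1) c 0 i *: opA L (n - i) x) *m v)^T *m invmx (opA_frame L x v) = c.
Proof. by move=> Fu; rewrite -opA_frame_mul mulmxK. Qed.

Lemma smooth_invmx U (A : X -> 'M[R]_n.+1) : open U -> smooth_on U A ->
  (forall x, U x -> A x \in unitmx) -> smooth_on U (fun x => invmx (A x)).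
Proof.
move=> oU sA Au.
have d0 x : U x -> \det (A x) != 0 by move=> /Au; rewrite unitmxE unitfE.
have sadj : smooth_on U (fun x => \adj (A x)).
  apply/smooth_mxP => // i j.
  have : smooth_on U (fun x => (-1) ^+ (j + i) * \det (row' j (col' i (A x)))).
    apply: smoothM => //; first exact: smooth_cst.
    apply: (@smooth_det R n) => //; apply/smooth_mxP => // k k'.
    have /smooth_mxP sAe := sA.
    by apply: smooth_eq (sAe oU (lift j k) (lift i k')) => // x _; rewrite !mxE.
  by apply: smooth_eq => // x _; rewrite mxE.
have := smooth_scalemx oU (smoothV oU d0 (smooth_det oU sA)) sadj.
by apply: smooth_eq => // x Ux; rewrite /invmx Au.
Qed.

Lemma smooth_trmx (p q : nat) U (A : X -> 'M[R]_(p, q)) : open U -> smooth_on U A ->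
  smooth_on U (fun x => (A x)^T).
Proof.
move=> oU /smooth_mxP sA; apply/smooth_mxP => // i j.
by apply: smooth_eq (sA oU j i) => // x _; rewrite mxE.
Qed.

Lemma smooth_opA_frame U L v : open U -> smooth_on U L ->
  smooth_on U (fun x => opA_frame L x v).
Proof.
move=> oU sL; apply/smooth_mxP => // i j.
have /smooth_mxP sA := smooth_mulmx oU (smooth_opA (n - i) oU sL) (smooth_cst U v).
by apply: smooth_eq (sA oU j 0) => // x _; rewrite !mxE.
Qed.

(** The cyclic vector [vv x] is picked at each point separately, but the coefficients of B do not
    depend on the choice. Near x0 they can be computed with the constant vector [vv x0], where they
    are smooth by the formula for the inverse matrix; so the pointwise definition is smooth on all
    of U. *)
Lemma smooth_opA_coef U L (B : opfield R n) : open U -> smooth_on U L -> smooth_on U B ->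
  gl_regular U L -> (forall x, U x -> L x *m B x = B x *m L x) ->
  exists2 f : 'I_n.+1 -> X -> R,
    (forall i, smooth_on U (f i)) & forall x, U x -> B x = opB L f x.
Proof.
move=> oU sL sB rL LB.
have /choice [vv vvP] : forall x, exists v, U x -> cyclic_vec (L x) v.
  move=> x; have [Ux|nUx] := pselect (U x); last by exists 0.
  by have [v cv] := gl_regular_cyclic rL Ux; exists v.
pose c v x := (B x *m v)^T *m invmx (opA_frame L x v).
exists (fun i x => c (vv x) x 0 i) => [i|x Ux]; last first.
  exact: comm_opA_coef (vvP _ Ux) (LB _ Ux).
apply: smooth_locally => x0 Ux0; pose v := vv x0.
(* The closure properties of smooth maps are stated on open sets, hence the interior; x0 lies in it
   because the determinant of the frame is continuous and nonzero there. *)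
pose V := interior [set x | U x /\ opA_frame L x v \in unitmx].
have VP x : V x -> U x /\ opA_frame L x v \in unitmx by exact: interior_subset.
have oV : open V by exact: open_interior.
have VU : V `<=` U by move=> x /VP[].
have sF := smooth_opA_frame v oU sL.
exists V.
  apply: filterI; first exact: open_nbhs_nbhs.
  have d0 : \det (opA_frame L x0 v) != 0.
    by rewrite -unitfE -unitmxE; apply: opA_frame_unit; exact: vvP.
  have := differentiable_continuous (smooth_diff (smooth_det oU sF) Ux0).
  move=> /cvgr_neq0 /(_ d0); apply: filterS => x.
  by rewrite unitmxE unitfE.
have sc : smooth_on V (c v).
  apply: smooth_mulmx => //.
    apply: smooth_trmx => //; apply: smooth_mulmx => //; [exact: smoothS sB|exact: smooth_cst].
  apply: smooth_invmx => //; first exact: smoothS sF.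
  by move=> x /VP[].
have /smooth_mxP sce := sc; apply: smooth_eq (sce oV 0 i) => // x Vx.
have [Ux Fu] := VP _ Vx; congr (fun_of_matrix _ _ _).
rewrite {1}/c {1}(comm_opA_coef (vvP _ Ux) (LB _ Ux)).
exact: opA_coef_unique.
Qed.

End Coefficients.

(** * Symmetries and conservation laws *)

Section MainStatements.
Context {R : realType} {n : nat}.
Local Notation X := 'cV[R]_n.+1.
Implicit Types (U : set X) (L M B : opfield R n) (x u v p : X) (f g : 'I_n.+1 -> X -> R).

Lemma hierarchy_dfun U L f i x : hierarchy U L f -> U x ->
  dfun (f i) x = dfun (f ord0) x *m L x ^+ i.
Proof.
move=> [_ _ H] Ux; case: i => m lem; elim: m lem => [|m IH] lem.
  by rewrite expr0 mulmx1; congr (dfun (f _) x); exact: val_inj.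
by rewrite -(H (Ordinal (ltnW lem)) (Ordinal lem) erefl x Ux) /op_dual IH exprSr mulmxA.
Qed.

Lemma hierarchy_common_symmetry U L f : open U -> smooth_on U L -> nijenhuis U L ->
  hierarchy U L f -> common_symmetry U L (opB L f).
Proof.
move=> oU sL NL H j; have [sf _ _] := H.
apply/symmetryP => //; first exact: smooth_opA.
split=> [|x Ux|x v Ux]; first exact: smooth_opB.
  rewrite /opB mulmx_sumr mulmx_suml; apply: eq_bigr => i _.
  by rewrite -scalemxAr -scalemxAl opA_commA.
have jn : (j <= n.+1)%N by exact: ltnW.
have df i := smooth_diff (sf i) Ux.
rewrite (sym_tensor_opB _ oU sL NL Ux df jn).
(* Q is the sum of [commutator_opA_pow] for K = v df_0. Since df_i = df_0 L^i in a hierarchy, the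
   bracket is the commutator of A_j and Q, applied to v. *)
pose Q := \sum_(i < n.+1) opA L (n - i) x *m (v *m dfun (f ord0) x) *m L x ^+ i.
have LQ : L x *m Q = Q *m L x.
  apply/eqP; rewrite -subr_eq0 commutator_opA_pow opA_Cayley_Hamilton.
  by rewrite mul0mx mulmx0 subrr.
transitivity ((opA L j x *m Q - Q *m opA L j x) *m v); last first.
  by rewrite (opA_comm j LQ) subrr mul0mx.
rewrite mulmx_sumr mulmx_suml -sumrB mulmx_suml; apply: eq_bigr => i _.
rewrite !scale_derive // (hierarchy_dfun i H Ux) mulmxBl !mulmxA.
by [].
Qed.

Lemma opB_symmetry_hierarchy U L f : open U -> smooth_on U L -> nijenhuis U L ->
  gl_regular U L -> (forall i, smooth_on U (f i)) -> (0 < n)%N ->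
  (forall x v, U x -> sym_tensor (opA L 1) (opB L f) x v v = 0) ->
  forall i j : 'I_n.+1, j = i.+1 :> nat ->
  forall x, U x -> dfun (f i) x *m L x = dfun (f j) x.
Proof.
move=> oU sL NL rL sf n0 S i j ji x Ux.
have df k := smooth_diff (sf k) Ux.
have [v cv] := gl_regular_cyclic rL Ux.
apply/eqP; rewrite -subr_eq0; apply/eqP.
apply: (cyclic_vec_dense cv) => u cu.
pose a k := 'D_u (f (inord k)) x.
pose b k := 'D_(L x *m u) (f (inord k)) x.
have H : a i.+1 = b i.
  apply: (opA_recurrence cu); last by rewrite -ltnS -ji.
  rewrite -[RHS](S x u Ux) (sym_tensor_opB _ oU sL NL Ux df); last exact: leqW.
  (* A_1 is L - sigma_1 Id, and the sigma_1 parts of the two terms cancel, leaving L in place of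
     A_1. *)
  apply: eq_bigr => k _; rewrite /a /b inord_val /= mulmx1 !mulmxBl mul_scalar_mx.
  rewrite (deriveDdir _ _ (df k)) (deriveNdir _ (df k)) mul_scalar_mx (deriveZdir _ _ (df k)).
  rewrite -scalemxAl.
  move: ('D_u (f k) x) ('D_(L x *m u) (f k) x) (sigma L 1 x) => c1 c2 c3.
  by rewrite /GRing.scale /=; mx_lincomb.
rewrite mulmxBl -mulmxA !dfun_mul //.
have <- : a i.+1 = 'D_u (f j) x by rewrite /a -ji inord_val.
have <- : b i = 'D_(L x *m u) (f i) x by rewrite /b inord_val.
by rewrite H subrr.
Qed.

Lemma common_symmetry_hierarchy U L B : open U -> smooth_on U L -> nijenhuis U L ->
  gl_regular U L -> common_symmetry U L B ->
  exists2 f, hierarchy U L f & forall x, U x -> B x = opB L f x.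
Proof.
move=> oU sL NL rL SB.
have [sB _ _] := SB ord0.
have LB x : U x -> L x *m B x = B x *m L x.
  (* In dimension one A_1 is not in the family, but 1 x 1 matrices commute. Otherwise B commutes
     with A_1, which differs from L by a scalar matrix. *)
  move=> Ux; have [n0|n0] := posnP n.
    by rewrite n0 in L B x {SB sB Ux sL NL rL} *;
       rewrite [L x]mx11_scalar mul_scalar_mx mul_mx_scalar.
  have i1 : (1 < n.+1)%N by [].
  have [_ /(_ x Ux) + _] := SB (Ordinal i1).
  rewrite /= mulmx1 mulmxBl mulmxBr scalar_mxC => /eqP.
  by rewrite -subr_eq0 opprB addrA subrK subr_eq0 => /eqP.
have [f sf Bf] := smooth_opA_coef oU sL sB rL LB.
exists f => //.
have step (i j : 'I_n.+1) : j = i.+1 :> nat -> forall x, U x -> dfun (f i) x *m L x = dfun (f j) x.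
  move=> ji; have n0 : (0 < n)%N by rewrite -ltnS (leq_ltn_trans _ (ltn_ord j)) // ji.
  apply: (opB_symmetry_hierarchy oU sL NL rL sf n0) => // x v Ux.
  have i1 : (1 < n.+1)%N by [].
  have /(symmetryP _ oU (smooth_opA 1 oU sL)) [_ _ S] := SB (Ordinal i1).
  by rewrite -(sym_tensor_eq _ _ _ oU Ux Bf); exact: S.
split=> //; split; [exact: smooth_dfun|exact: closed_dfun|].
(* It remains to see that L^* df_0 is closed: in dimension one every 1-form is, and otherwise it is
   the exact form df_1. *)
have [n0|n0] := posnP n.
  have ord1n (k : 'I_n.+1) : k = ord0.
    by apply: val_inj; apply/eqP; rewrite -leqn0 -n0 -ltnS /=.
  by move=> x Ux i j; rewrite (ord1n i) (ord1n j).
have i1 : (1 < n.+1)%N by [].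
apply: (closed_form_eq oU (alpha := dfun (f (Ordinal i1)))); last exact: closed_dfun.
by move=> x Ux; rewrite -(step ord0).
Qed.

Lemma symmetry_dfun U L M g : open U -> smooth_on U L -> nijenhuis U L ->
  gl_regular U L -> symmetry U L M -> (forall i, smooth_on U (g i)) ->
  (forall x, U x -> M x = op_poly L g x) ->
  forall (i : 'I_n.+1) x, U x -> dfun (g ord0) x *m opA L i x = dfun (g i) x.
Proof.
move=> oU sL NL rL /(symmetryP _ oU sL) [_ _ S] sg Mg i x Ux.
have dg k := smooth_diff (sg k) Ux.
have [v cv] := gl_regular_cyclic rL Ux.
(* This is the recursion of the A_k, transposed and applied to dg_0; the induction at the end only
   unfolds it. *)
have step (k l : 'I_n.+1) : l = k.+1 :> nat ->
    dfun (g l) x = dfun (g k) x *m L x - sigma L l x *: dfun (g ord0) x.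
  move=> lk; apply/eqP; rewrite -subr_eq0; apply/eqP.
  apply: (cyclic_vec_dense cv) => u cu.
  pose a k := 'D_u (g (inord k)) x.
  pose b k := 'D_(L x *m u) (g (inord k)) x.
  have H : a k.+1 = b k - a 0%N * sigma L k.+1 x.
    apply: (pow_recurrence cu); last by rewrite -ltnS -lk.
    rewrite -[RHS](S x u Ux) (sym_tensor_eq _ _ _ oU Ux Mg).
    rewrite (sym_tensor_op_poly _ oU sL NL Ux dg).
    by apply: eq_bigr => m _; rewrite /a /b inord_val.
  have ga : 'D_u (g l) x = a k.+1 by rewrite /a -lk inord_val.
  have gb : 'D_(L x *m u) (g k) x = b k by rewrite /b inord_val.
  have g0 : 'D_u (g ord0) x = a 0%N.
    by rewrite /a (_ : inord 0 = ord0) //; apply: val_inj; rewrite /= inordK.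
  rewrite !mulmxBl -mulmxA -scalemxAl !dfun_mul // ga gb g0 H lk.
  by rewrite scale_scalar_mx [sigma _ _ _ * _]mulrC -!raddfB subrr raddf0.
case: i => m lem; elim: m lem => [|m IH] lem.
  by rewrite /= mulmx1; congr (dfun (g _) x); exact: val_inj.
rewrite (step (Ordinal (ltnW lem)) (Ordinal lem) erefl) -IH /= mulmxBr -!mulmxA opA_commL.
by rewrite mul_mx_scalar.
Qed.

Lemma symmetry_common_conservation_law U L M g : open U -> smooth_on U L ->
  nijenhuis U L -> gl_regular U L -> symmetry U L M -> (forall i, smooth_on U (g i)) ->
  (forall x, U x -> M x = op_poly L g x) -> common_conservation_law U L (dfun (g ord0)).
Proof.
move=> oU sL NL rL SM sg Mg i.
split; [exact: smooth_dfun|exact: closed_dfun|].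
apply: (closed_form_eq oU (alpha := dfun (g i))); last exact: closed_dfun.
by move=> x Ux; rewrite /op_dual (symmetry_dfun oU sL NL rL SM sg Mg).
Qed.

Lemma common_conservation_law_symmetry U L p (alpha : oneform R n) : open U -> U p ->
  smooth_on U L -> nijenhuis U L -> common_conservation_law U L alpha ->
  exists V g, [/\ open V /\ V p, V `<=` U,
    symmetry V L (op_poly L g) /\ (forall i, smooth_on V (g i))
    & forall x, V x -> alpha x = dfun (g ord0) x].
Proof.
move=> oU Up sL NL Ca.
have nU : nbhs p U by exact: open_nbhs_nbhs.
have /nbhs_ballP [e /= e0 eU] := nU.
have oV : open (ball p e) by exact: ball_open.
have /choice [g gP] : forall i : 'I_n.+1, exists h : X -> R, smooth_on (ball p e) h /\
    forall x, ball p e x -> dfun h x = op_dual (opA L i) alpha x.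
  move=> i; have [sa _ ca] := Ca i.
  have [h sh dh] := @poincare R n p e (op_dual (opA L i) alpha) (smoothS eU
    (smooth_mulmx oU sa (smooth_opA i oU sL))) (fun x Vx => ca x (eU x Vx)).
  by exists h.
have sg i : smooth_on (ball p e) (g i) by have [] := gP i.
exists (ball p e), g; split=> //.
- by split=> //; exact: ballxx.
- split=> //; apply/symmetryP => //; first exact: smoothS sL.
  have sLV := smoothS eU sL.
  split=> [|x Vx|x v Vx]; first exact: smooth_op_poly.
    rewrite /op_poly mulmx_sumr mulmx_suml; apply: eq_bigr => i _.
    by rewrite -scalemxAr -scalemxAl -[L x *m _]exprS exprSr.
  have Ux := eU x Vx.
  have dg i := smooth_diff (sg i) Vx.
  rewrite (sym_tensor_op_poly _ oU sL NL Ux dg).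
  (* P is the sum of [commutator_pow_opA] for K = v alpha. Since dg_i = A_i^* alpha, the bracket is
     the commutator of L and P applied to v, and it vanishes because A_(n+1) = 0. *)
  pose P := \sum_(i < n.+1) L x ^+ (n - i) *m (v *m alpha x) *m opA L i x.
  transitivity ((L x *m P - P *m L x) *m v); last first.
    rewrite (commutator_pow_opA L x _ n.+1) opA_Cayley_Hamilton.
    by rewrite mul0mx mulmx0 subrr mul0mx.
  rewrite mulmx_sumr mulmx_suml -sumrB mulmx_suml; apply: eq_bigr => i _.
  rewrite !scale_derive //; have [_ ->] := gP i; last by [].
  by rewrite /op_dual mulmxBl !mulmxA.
- by move=> x Vx; have [_ ->] := gP ord0; rewrite // /op_dual mulmx1.
Qed.

End MainStatements.

Theorem theorem1p6 (R : realType) (n : nat) (p : 'cV[R]_n.+1)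
    (U : set 'cV[R]_n.+1) (L : opfield R n) :
  open U -> U p ->
  smooth_on U L -> nijenhuis U L -> gl_regular U L ->
  [/\ forall f : 'I_n.+1 -> 'cV[R]_n.+1 -> R,
        hierarchy U L f -> common_symmetry U L (opB L f),
      forall B : opfield R n, common_symmetry U L B ->
        exists2 f : 'I_n.+1 -> 'cV[R]_n.+1 -> R,
          hierarchy U L f & forall x, U x -> B x = opB L f x,
      forall (M : opfield R n) (g : 'I_n.+1 -> 'cV[R]_n.+1 -> R),
        symmetry U L M -> (forall i, smooth_on U (g i)) ->
        (forall x, U x -> M x = op_poly L g x) ->
        common_conservation_law U L (dfun (g ord0)) /\
        (forall (i : 'I_n.+1) x, U x ->
           op_dual (opA L i) (dfun (g ord0)) x = dfun (g i) x)
    & forall alpha : oneform R n, common_conservation_law U L alpha ->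
        exists (V : set 'cV[R]_n.+1) (M : opfield R n)
               (g : 'I_n.+1 -> 'cV[R]_n.+1 -> R),
          [/\ open V /\ V p, V `<=` U,
              symmetry V L M /\ (forall i, smooth_on V (g i)),
              forall x, V x -> M x = op_poly L g x
            & forall x, V x -> alpha x = dfun (g ord0) x]].
Proof.
move=> oU Up sL NL rL; split.
- by move=> f; exact: hierarchy_common_symmetry.
- by move=> B; exact: common_symmetry_hierarchy.
- move=> M g SM sg Mg; split; last exact: (symmetry_dfun oU sL NL rL SM).
  exact: (symmetry_common_conservation_law oU sL NL rL SM).
- move=> alpha Ca.
  have [V [g [VP VU SV av]]] := common_conservation_law_symmetry oU Up sL NL Ca.
  by exists V, (op_poly L g), g.
Qed.
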